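(* The continuous oriented chromatic number of the directed Schreier graph $\vec F(2^{\mathbb Z^2})$ is $\chi_{co}(\vec F(2^{\mathbb Z^2}))=7$.
   Context: A directed graph (digraph) $D$ is an irreflexive binary relation $A(D)$ (the arc set) on a vertex set $V(D)$; an arc $(x,y)$ is written $x\to y$. An oriented graph is a digraph whose arc relation is asymmetric: $x\to y$ implies not $y\to x$. A graph homomorphism between digraphs is a map of vertices sending every arc to an arc. $2^{\mathbb Z^2}=\{0,1\}^{\mathbb Z^2}$ carries the product topology and the shift action $(g\cdot x)(h)=x(h+g)$ for $g,h\in\mathbb Z^2$. Its free part is $F(2^{\mathbb Z^2})=\{x: g\cdot x\neq x \text{ for every } g\neq(0,0)\}$ with the subspace topology. With $e_1=(1,0)$, $e_2=(0,1)$, the directed Schreier graph $\vec F(2^{\mathbb Z^2})$ has vertex set $F(2^{\mathbb Z^2})$ and arcs $x\to e_1\cdot x$ and $x\to e_2\cdot x$ for all $x$; it is an oriented graph. For an oriented graph $G$ whose vertex set is a topological space, the continuous oriented chromatic number $\chi_{co}(G)$ is the least $|V(H)|$ over finite oriented graphs $H$ (with $V(H)$ discrete) for which there is a continuous graph homomorphism $G\to H$. *)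

(* Defs.v *)
From HB Require Import structures.
From mathcomp Require Import all_boot all_order all_algebra.
From mathcomp Require Import boolp classical_sets functions topology.

Set Implicit Arguments.
Unset Strict Implicit.
Unset Printing Implicit Defensive.

Import GRing.Theory.

Local Open Scope classical_set_scope.
Local Open Scope ring_scope.

Record digraph (V : Type) := Digraph {
  arc : V -> V -> Prop;
  arc_irreflexive : forall x, ~ arc x x }.

Record oriented_graph (V : Type) := OrientedGraph {
  digraph_of :> digraph V;
  arc_asymmetric : forall x y, arc digraph_of x y -> ~ arc digraph_of y x }.

Definition graph_hom (V W : Type) (G : digraph V) (H : digraph W)
    (f : V -> W) : Prop :=
  forall x y, arc G x y -> arc H (f x) (f y).

Section ContinuousOrientedChromaticNumber.
Variables (V : topologicalType) (G : oriented_graph V).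

Definition has_continuous_hom_of_size (n : nat) : Prop :=
  exists (W : finType) (H : oriented_graph W) (f : V -> discrete_topology W),
    [/\ #|W| = n, continuous f & graph_hom G H f].

(* [None] when no finite oriented graph admits a continuous homomorphism
   from G. *)
Definition chi_co : option nat :=
  match pselect (exists n, `[< has_continuous_hom_of_size n >]) with
  | left ex => Some (ex_minn ex)
  | right _ => None
  end.

Lemma chi_coP (n : nat) :
  chi_co = Some n <->
  has_continuous_hom_of_size n /\
  (forall m, has_continuous_hom_of_size m -> (n <= m)%N).
Proof.
rewrite /chi_co; case: pselect => [ex|nex]; last first.
  by split=> // -[hn _]; case: nex; exists n; apply/asboolP.
case: ex_minnP => k /asboolP hk kmin; split.
  by case=> <-; split=> // m hm; apply: kmin; apply/asboolP.
case=> hn nmin; congr Some; apply/eqP; rewrite eqn_leq nmin // andbT.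
by apply: kmin; apply/asboolP.
Qed.

End ContinuousOrientedChromaticNumber.

Definition Zsq : zmodType := (int * int)%type.

Definition e1 : Zsq := (1, 0).
Definition e2 : Zsq := (0, 1).

Definition shift_space : topologicalType := {ptws Zsq -> bool}.

Definition shift (g : Zsq) (x : shift_space) : shift_space :=
  fun h => x (h + g).

Definition free_part : set shift_space :=
  [set x | forall g : Zsq, g <> 0 -> shift g x <> x].

Lemma shiftD (g h : Zsq) (x : shift_space) :
  shift (g + h) x = shift g (shift h x).
Proof. by apply/funext => k; rewrite /shift addrA. Qed.

Lemma free_part_shift (g : Zsq) (x : shift_space) :
  free_part x -> free_part (shift g x).
Proof.
move=> Fx h h0 e; apply: (Fx h h0); apply/funext => k.
have := congr1 (fun y : shift_space => y (k - g)) e.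
by rewrite /shift addrAC !subrK.
Qed.

Definition free_part_space : topologicalType := set_type free_part.

Lemma free_partP (x : free_part_space) (g : Zsq) :
  g <> 0 -> shift g (set_val x) <> set_val x.
Proof. by move: g; exact: (set_valP x). Qed.

Definition schreier_arc (x y : free_part_space) : Prop :=
  set_val y = shift e1 (set_val x) \/ set_val y = shift e2 (set_val x).

Lemma schreier_arc_irreflexive (x : free_part_space) : ~ schreier_arc x x.
Proof. by case=> /esym; exact: free_partP. Qed.

Lemma schreier_arc_asymmetric (x y : free_part_space) :
  schreier_arc x y -> ~ schreier_arc y x.
Proof.
by move=> xy [] /esym; case: xy => ->; rewrite -shiftD; exact: free_partP.
Qed.

Definition schreier_digraph : digraph free_part_space :=
  Digraph schreier_arc_irreflexive.

Definition schreier_graph : oriented_graph free_part_space :=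
  @OrientedGraph _ schreier_digraph schreier_arc_asymmetric.

(* Main.v *)
Require Import Defs.
From mathcomp Require Import all_boot all_order all_algebra.
From mathcomp Require Import boolp classical_sets functions topology.
From mathcomp Require Import zify.

(** The theorem has two halves: a continuous homomorphism to one particular
    tournament on seven vertices, and an obstruction for every oriented graph
    on at most six.  On the free part, a continuous function to a discrete set
    is one whose value at [x] depends on a finite window of [x], so both halves
    are about local rules on the orbits, which are copies of Z^2.

    Seven vertices suffice.  On one orbit, [(i, j) |-> i + j mod 3] is a
    homomorphism to the directed 3-cycle, but its phase cannot be chosen
    continuously and globally.  It can be chosen on the pieces of a partition:
    greedy choices along a continuous priority ([greedy]) give a clopen set of
    anchors that is separated and relatively dense ([anchor_sep],
    [anchor_max]), each anchor receives a square around it whose radius is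
    picked so that the side lines of nearby squares stay far from each other
    ([radius_sep]), and a point takes its phase from the square of highest
    priority that covers it.  A window of bounded size then meets at most one
    vertical and one horizontal line of discontinuity of the phase
    ([same_line]), so it shows four quadrants with four arbitrary phases.  The
    seven-vertex tournament [arc7] consists of two 3-cycles [w] and [u] and a
    vertex [z]; a detour [w_i -> u_i -> w_(i+1)] through the second cycle
    delays the phase by one step, so a wall of detours joins two phases, and
    [z], which every [u_i] beats and which beats every [w_i], lets three
    parallel detours, which change no phase, end together.  Every four-quadrant pattern can be filled in
    this way ([fill_okP], a finite verification).

    Six do not suffice.  Place the vertices of a tournament on a circle, some
    perhaps at the same place; a walk then has a winding number, the number of times that it crosses a fixed cut.
    If the two sides of every square of the grid have the same winding, then
    the winding of a walk in the grid depends only on its end points.  Let a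
    column of a plane map be periodic with period [p], a column further right
    with period [p + 1], and everything in between with period [p (p + 1)].
    Comparing the columns over the height [p (p + 1)] gives
    [(p + 1) a = p b] for the windings [a] and [b] of one period, so [p]
    divides [a]; but [0 <= a <= p], and both extreme values are impossible
    ([no_winding]).  Such columns exist for every continuous map: [stripes] is
    a point whose orbit closure lies in the free part, so that by compactness
    the map restricted to its orbit is given by one window
    ([uniform_window]), and it contains arbitrarily wide vertical strips with
    consecutive periods ([two_strips]).  It remains to find a good position on
    the circle for each tournament on six vertices.  By Redei's theorem there
    are only 2^10 of them up to relabelling, and a finite verification
    ([all_certifiable]) finds one, except that sometimes one kind of bad square
    is left; that square can be removed beforehand by a local change of the map
    ([flip_corner]). *)

Set Implicit Arguments.
Unset Strict Implicit.
Unset Printing Implicit Defensive.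

Import Order.TTheory GRing.Theory Num.Theory.

Local Open Scope ring_scope.

Local Notation X := free_part_space.

(** * Continuity as dependence on a finite window *)

Section Windows.
Local Open Scope classical_set_scope.

Lemma Zsq_ext (g h : Zsq) : g.1 = h.1 -> g.2 = h.2 -> g = h.
Proof. by case: g h => a b [c d] /= -> ->. Qed.

Definition in_box (N : nat) (h : Zsq) : bool := (`|h.1| <= N) && (`|h.2| <= N).

Definition agree (N : nat) (x y : shift_space) : Prop :=
  forall h, in_box N h -> x h = y h.

Definition box (N : nat) : seq Zsq :=
  [seq ((i%:Z - N%:Z, j%:Z - N%:Z) : Zsq) | i <- iota 0 (N.*2.+1), j <- iota 0 (N.*2.+1)].

Lemma mem_box N h : (h \in box N) = in_box N h.
Proof.
apply/idP/idP.
  by case/allpairsP => -[i j] [+ + ->]; rewrite !mem_iota /in_box /=; lia.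
case: h => a b; rewrite /in_box /= => Hab.
apply/allpairsP; exists (absz (a + N%:Z), absz (b + N%:Z)).
by rewrite !mem_iota /=; split; [lia|lia|congr pair; lia].
Qed.

Lemma agree_trans N x y z : agree N x y -> agree N y z -> agree N x z.
Proof. by move=> H1 H2 h hN; rewrite H1 // H2. Qed.

Lemma agree_le M N x y : (M <= N)%N -> agree N x y -> agree M x y.
Proof. by move=> MN H h hM; apply: H; move: hM; rewrite /in_box; lia. Qed.

Lemma agree_max2 N M x y : agree (maxn N M) x y -> agree N x y /\ agree M x y.
Proof. by move=> H; split; apply: agree_le H; rewrite ?leq_maxl ?leq_maxr. Qed.

(** The windows form a base of the product topology: one inclusion is a finite
    intersection of coordinate conditions, and for the other the filter of all
    windows around [x] converges to [x] in each coordinate. *)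
Lemma nbhs_shift_spaceP (x : shift_space) (U : set shift_space) :
  nbhs x U <-> exists N, forall y, agree N x y -> U y.
Proof.
split; last first.
  case=> N HN; have F s : nbhs x [set y : shift_space | all (fun h => x h == y h) s].
    elim: s => [|h s IH] /=; first by apply: filterE.
    near=> y => /=; apply/andP; split; last by near: y.
    near: y.
    have P : nbhs x [set y : shift_space | y h = x h].
      exact: (@proj_continuous _ (fun _ : Zsq => bool) h x _ (discrete_set1 (x h))).
    by apply: filterS P => y /= ->.
  apply: filterS (F (box N)) => y /allP H; apply: HN => h hN.
  by apply/eqP/H; rewrite mem_box.
pose W : set_system shift_space := [set V | exists N, forall y, agree N x y -> V y].
have FW : Filter W.
  split; first by exists 0%N.
    move=> P Q [N HN] [M HM]; exists (maxn N M) => y H; split.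
      by apply: HN; apply: agree_le H; exact: leq_maxl.
    by apply: HM; apply: agree_le H; exact: leq_maxr.
  by move=> P Q PQ [N HN]; exists N => y /HN /PQ.
suff /(_ U) : W --> x by [].
apply/cvg_sup => h V [B [[C oC <-] Cx] CV].
exists (maxn `|h.1| `|h.2|)%N => y H; apply: CV => /=; rewrite /= -H //.
by rewrite /in_box; lia.
Unshelve. all: by end_near.
Qed.

Lemma nbhs_free_partP (x : X) (U : set X) :
  nbhs x U <-> exists N, forall y : X, agree N (set_val x) (set_val y) -> U y.
Proof.
split.
  case=> B [[C oC <-] Cx] CU.
  have /nbhs_shift_spaceP [N HN] : nbhs (set_val x : shift_space) C.
    by apply: open_nbhs_nbhs.
  by exists N => y /HN Cy; exact: CU.
case=> N HN; pose A := [set y : shift_space | agree N (set_val x) y].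
have nA : nbhs (set_val x : shift_space) A by apply/nbhs_shift_spaceP; exists N.
have : nbhs x ((set_val : X -> shift_space) @^-1` A) by exact: initial_continuous nA.
by apply: filterS => y /HN.
Qed.

Definition local_at (T : Type) (f : X -> T) (x : X) : Prop :=
  exists N, forall y : X, agree N (set_val x) (set_val y) -> f y = f x.

Definition local (T : Type) (f : X -> T) : Prop := forall x, local_at f x.

Lemma continuous_local (W : choiceType) (f : X -> discrete_topology W) :
  continuous f <-> local f.
Proof.
split=> [cf x|lf x].
  have /nbhs_free_partP [N HN] := (cf x _ (discrete_set1 (f x))).
  by exists N => y /HN.
move=> U; rewrite nbhs_principalE => /principal_filterP Ux.
suff : nbhs x (f @^-1` U) by [].
apply/nbhs_free_partP; have [N HN] := lf x; exists N => y /HN fy.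
by rewrite /preimage /= fy.
Qed.

End Windows.

(** * The action of Z^2 and closure properties of local functions *)

Definition act (g : Zsq) (x : X) : X :=
  exist _ (shift g (set_val x)) (mem_set (free_part_shift (g := g) (set_valP x))).

Lemma act_val g x h : set_val (act g x) h = set_val x (h + g).
Proof. by []. Qed.

Lemma act0 x : act 0 x = x.
Proof. by apply/val_inj/funext => h /=; rewrite /shift addr0. Qed.

Lemma actD g h x : act (g + h) x = act g (act h x).
Proof. by apply/val_inj; exact: shiftD. Qed.

Lemma act_inj_free (g : Zsq) (x : X) : g != 0 -> act g x != x.
Proof. by move=> g0; apply/eqP => /(congr1 set_val); apply: free_partP; exact/eqP. Qed.

Lemma act_oppK d x : act (- d) (act d x) = x.
Proof. by rewrite -actD addNr act0. Qed.

Lemma schreier_arcP (x y : X) :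
  schreier_arc x y <-> y = act e1 x \/ y = act e2 x.
Proof.
by split=> -[H|H]; [left|right|left|right];
  [apply: val_inj|apply: val_inj|rewrite H|rewrite H].
Qed.

Definition norm (h : Zsq) : nat := maxn `|h.1| `|h.2|.

Lemma agree_act N g (x y : X) :
  agree (N + norm g) (set_val x) (set_val y) -> agree N (set_val (act g x)) (set_val (act g y)).
Proof.
move=> H h hN; rewrite !act_val; apply: H; move: hN; rewrite /in_box /norm /=; lia.
Qed.

Lemma local_at_act (T : Type) (f : X -> T) g x :
  local_at f (act g x) -> local_at (fun x => f (act g x)) x.
Proof. by case=> N HN; exists (N + norm g)%N => y /agree_act; exact: HN. Qed.

Lemma local_at_const (T : Type) (c : T) x : local_at (fun _ => c) x.
Proof. by exists 0%N. Qed.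

Lemma local_at_comp2 (S T U : Type) (f : X -> S) (h : X -> T) (k : S -> T -> U) x :
  local_at f x -> local_at h x -> local_at (fun y => k (f y) (h y)) x.
Proof.
case=> [N HN] [M HM]; exists (maxn N M) => y /agree_max2[yN yM].
by rewrite HN // HM.
Qed.

Lemma local_at_comp (S T : Type) (f : X -> S) (k : S -> T) x :
  local_at f x -> local_at (fun y => k (f y)) x.
Proof. by case=> N HN; exists N => y /HN ->. Qed.

Lemma local_at_map (I : eqType) (T : Type) (s : seq I) (f : I -> X -> T) x :
  (forall i, i \in s -> local_at (f i) x) -> local_at (fun y => [seq f i y | i <- s]) x.
Proof.
elim: s => [|i s IH] lf /=; first exact: local_at_const.
apply: (local_at_comp2 cons); first by apply: lf; rewrite mem_head.
by apply: IH => j js; apply: lf; rewrite inE js orbT.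
Qed.

Lemma local_at_filter (I : eqType) (s : seq I) (P : I -> X -> bool) x :
  (forall i, i \in s -> local_at (P i) x) -> local_at (fun y => [seq i <- s | P i y]) x.
Proof.
elim: s => [|i s IH] lf /=; first exact: local_at_const.
apply: (local_at_comp2 (fun (b : bool) t => if b then i :: t else t)).
  by apply: lf; rewrite mem_head.
by apply: IH => j js; apply: lf; rewrite inE js orbT.
Qed.

Lemma local_at_all (I : eqType) (s : seq I) (P : I -> X -> bool) x :
  (forall i, i \in s -> local_at (P i) x) -> local_at (fun y => all (P^~ y) s) x.
Proof.
elim: s => [|i s IH] lf /=; first exact: local_at_const.
apply: (local_at_comp2 andb); first by apply: lf; rewrite mem_head.
by apply: IH => j js; apply: lf; rewrite inE js orbT.
Qed.

(** For a locally constant parameter, here the value of [f], locality may be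
    checked with the parameter frozen at its value at [x]. *)
Lemma local_at_bind (S T : Type) (f : X -> S) (h : S -> X -> T) x :
  local_at f x -> local_at (h (f x)) x -> local_at (fun y => h (f y) y) x.
Proof.
case=> [N HN] [M HM]; exists (maxn N M) => y /agree_max2[yN yM].
by rewrite HN // HM.
Qed.

(** * Greedy constructions on the free part *)

Section PatternCode.
Variable L : nat.

Definition separates (m : nat) (x : X) : bool :=
  all (fun d => (d == 0) || has (fun h => set_val x h != set_val x (h + d)) (box m)) (box L).

Lemma separates_ex x : exists m, separates m x.
Proof.
have H d : d != 0 -> exists h, set_val x h != set_val x (h + d).
  move=> d0; apply: contrapT => nH; have /eqP[] := act_inj_free x d0.
  apply/val_inj/funext => h; apply/esym/eqP/negPn/negP => hd.
  by apply: nH; exists h.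
rewrite /separates; elim: (box L) => [|d s [m IH]]; first by exists 0%N.
have [->|d0] := eqVneq d 0; first by exists m; apply/andP; split; [apply/orP; left; exact: eqxx|].
have [h hd] := H d d0; exists (maxn m (norm h)); apply/andP; split.
  by apply/orP; right; apply/hasP; exists h => //; rewrite mem_box /in_box /norm; lia.
apply: sub_all IH => e /orP[->//|/hasP[k kb ke]]; apply/orP; right.
by apply/hasP; exists k => //; move: kb; rewrite !mem_box /in_box; lia.
Qed.

Definition sep_radius (x : X) : nat := ex_minn (separates_ex x).

(** A locally constant function that separates any two points of an orbit at
    distance at most [L]: the pattern of [x] in a window that distinguishes [x]
    from all its translates by at most [L].  If [x] and such a translate had the
    same code, they would have the same pattern in a window that tells them
    apart. *)
Definition pattern_code (x : X) : nat :=
  pickle (sep_radius x, [seq set_val x h | h <- box (sep_radius x)]).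

Lemma pattern_code_neq d x : d \in box L -> d != 0 -> pattern_code (act d x) != pattern_code x.
Proof.
move=> dL d0; apply/eqP => /(pcan_inj pickleK) E0.
have mE : sep_radius (act d x) = sep_radius x := congr1 fst E0.
have E1 : [seq set_val (act d x) h | h <- box (sep_radius (act d x))]
        = [seq set_val x h | h <- box (sep_radius x)] := congr1 snd E0.
move: E1; rewrite mE => /eq_in_map E.
move: E {E0 mE}; rewrite /sep_radius; case: ex_minnP => m /allP sm _ E.
have /orP[/eqP d00|/hasP[h hm /eqP[]]] := sm d dL; first by rewrite d00 eqxx in d0.
by rewrite -act_val E.
Qed.

Lemma separates_agree m x y :
  agree (m + L) (set_val x) (set_val y) -> separates m y = separates m x.
Proof.
move=> H; apply: eq_in_all => d; rewrite mem_box => dL; congr orb.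
apply: eq_in_has => h; rewrite mem_box => hm.
by rewrite !H //; move: dL hm; rewrite /in_box /=; lia.
Qed.

Lemma local_pattern_code x : local_at pattern_code x.
Proof.
exists (sep_radius x + L)%N => y H; rewrite /pattern_code.
have E : sep_radius y = sep_radius x.
  rewrite /sep_radius in H *; case: ex_minnP H => m sm mmin H.
  case: ex_minnP => n sn nmin; apply/eqP; rewrite eqn_leq.
  have nm : (n <= m)%N by rewrite nmin // (separates_agree H).
  rewrite nm /= mmin // -(@separates_agree n _ y) //; apply: agree_le H.
  by rewrite leq_add2r.
by rewrite E; congr (pickle (_, _)); apply/eq_in_map => h; rewrite mem_box => hm; rewrite H //;
  move: hm; rewrite /in_box; lia.
Qed.

End PatternCode.

Section Greedy.
Variables (T : Type) (i : X -> nat) (Phi : seq Zsq) (ch : X -> seq (Zsq * T) -> T).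

Definition earlier (x : X) : seq Zsq := [seq d <- Phi | (i (act d x) < i x)%N].

Fixpoint greedy_rec (n : nat) (x : X) : T :=
  if n is n'.+1 then ch x [seq (d, greedy_rec n' (act d x)) | d <- earlier x]
  else ch x [::].

(** Every point chooses a label by the rule [ch] from the labels of those
    [Phi]-neighbours that have smaller priority [i]; since [i] takes values in
    the natural numbers, the recursion ends. *)
Definition greedy (x : X) : T := greedy_rec (i x).+1 x.

Lemma greedy_rec_stable n m x :
  (i x < n)%N -> (i x < m)%N -> greedy_rec n x = greedy_rec m x.
Proof.
elim: n m x => // n IH [//|m] x; rewrite !ltnS => xn xm /=; congr (ch x _).
apply/eq_in_map => d; rewrite mem_filter => /andP[dx _]; congr pair.
by apply: IH; apply: leq_trans dx _.
Qed.

Lemma greedyE x : greedy x = ch x [seq (d, greedy (act d x)) | d <- earlier x].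
Proof.
rewrite {1}/greedy /=; congr (ch x _).
apply/eq_in_map => d; rewrite mem_filter => /andP[dx _]; congr pair.
exact: greedy_rec_stable.
Qed.

Hypothesis li : forall x, local_at i x.
Hypothesis lch : forall s x, local_at (ch^~ s) x.

Lemma local_greedy x : local_at greedy x.
Proof.
have [n] := ubnP (i x); elim: n x => // n IH x xn.
have le : local_at earlier x.
  apply: local_at_filter => d _.
  apply: (local_at_comp2 (fun a b => (a < b)%N)) => //.
  by apply: local_at_act.
have lm : local_at (fun y => [seq (d, greedy (act d y)) | d <- earlier y]) x.
  apply: (local_at_bind (h := fun s y => [seq (d, greedy (act d y)) | d <- s]) le).
  apply: local_at_map => d; rewrite mem_filter => /andP[dx _].
  apply: (local_at_comp (fun t => (d, t))); apply: local_at_act; apply: IH.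
  by apply: leq_trans dx _.
rewrite (_ : greedy = fun y => ch y [seq (d, greedy (act d y)) | d <- earlier y]); last first.
  by apply/funext => y; exact: greedyE.
exact: (local_at_bind (h := fun s y => ch y s) lm).
Qed.

End Greedy.

(** * A tournament on seven vertices and its phase walls *)

Section SevenVertices.
Local Open Scope nat_scope.

(** Out-neighbours.  The vertices 0, 1, 2 form the cycle [w], the vertices
    3, 4, 5 the cycle [u], and 6 is [z]; [w_i] beats [u_i] and [u_(i+1)],
    [u_i] beats [w_(i+1)] and [z], and [z] beats [w].  Rotation of both cycles
    is an automorphism. *)
Definition out7 : seq (seq nat) :=
  [:: [:: 1; 3; 4]; [:: 2; 4; 5]; [:: 0; 5; 3];
      [:: 4; 1; 6]; [:: 5; 2; 6]; [:: 3; 0; 6]; [:: 0; 1; 2]].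

Definition arc7 (a b : nat) : bool := b \in nth [::] out7 a.

Definition rot7 (t v : nat) : nat :=
  if v < 3 then (v + t) %% 3 else if v < 6 then 3 + (v + t) %% 3 else v.

(** Row [d] is the horizontal cross-section of a wall to the right of which the
    phase is [d] larger.  Entry [k] is the vertex [k] steps after the line of
    discontinuity, in the frame rotated so that the phase continued from the
    left is 0 at that place.  One detour through [u] loses one step, which is
    the jump by 2; two detours give the jump by 1.  Horizontal walls are the
    reflections of these in the diagonal. *)
Definition wall : seq (seq nat) :=
  [:: [:: 0; 0; 0; 0]; [:: 0; 5; 2; 4]; [:: 0; 5; 2; 2]].

(** The crossing of a vertical and a horizontal line, where four phases meet.
    In row [9 a + 3 b + c] the phases of the lower right, upper left and upper
    right quadrants exceed that of the lower left one by [a], [b] and [c];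
    entry [4 i + j] is the vertex [i] steps right of and [j] steps above the
    crossing, in the frame of the lower left phase.  The rows are solutions of
    the finite constraint problem with the walls as boundary values; they are
    empty where one of the two lines has no jump, so that a wall suffices. *)
Definition junction : seq (seq nat) := [::
  [::];
  [:: 0; 0; 0; 0; 0; 0; 0; 0; 0; 0; 0; 5; 0; 0; 5; 2];
  [:: 0; 0; 0; 0; 0; 0; 0; 0; 0; 0; 0; 5; 0; 0; 5; 2];
  [:: 0; 5; 5; 6; 0; 5; 6; 0; 3; 6; 0; 0; 0; 0; 0; 0];
  [::];
  [:: 0; 5; 5; 6; 0; 5; 6; 0; 3; 6; 0; 0; 0; 0; 5; 5];
  [:: 0; 5; 2; 2; 3; 6; 2; 4; 0; 0; 5; 6; 0; 3; 6; 0];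
  [:: 0; 5; 2; 2; 0; 5; 2; 2; 0; 5; 2; 4; 0; 5; 2; 4];
  [::];
  [:: 0; 0; 3; 0; 5; 5; 6; 0; 5; 6; 0; 0; 6; 0; 0; 0];
  [::];
  [:: 0; 0; 3; 0; 5; 5; 6; 0; 5; 6; 0; 5; 6; 0; 0; 5];
  [:: 0; 5; 2; 4; 5; 2; 4; 1; 2; 4; 1; 3; 4; 1; 3; 0];
  [:: 0; 5; 2; 4; 5; 2; 2; 4; 2; 2; 2; 4; 4; 4; 4; 1];
  [:: 0; 5; 2; 4; 5; 2; 4; 1; 2; 4; 1; 3; 4; 1; 3; 0];
  [:: 0; 5; 2; 2; 5; 2; 4; 4; 2; 4; 1; 1; 4; 1; 3; 3];
  [:: 0; 5; 2; 2; 5; 2; 2; 2; 2; 2; 2; 4; 4; 4; 4; 1];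
  [:: 0; 5; 5; 2; 5; 5; 6; 2; 5; 6; 0; 5; 6; 0; 0; 5];
  [:: 0; 3; 0; 0; 5; 6; 0; 3; 2; 2; 5; 6; 2; 4; 6; 0];
  [:: 0; 0; 0; 0; 5; 5; 5; 5; 2; 2; 2; 2; 2; 2; 4; 4];
  [::];
  [:: 0; 5; 2; 4; 5; 2; 4; 1; 2; 4; 1; 3; 2; 4; 1; 3];
  [:: 0; 5; 2; 4; 5; 2; 2; 4; 2; 2; 2; 4; 2; 2; 4; 1];
  [:: 0; 5; 5; 6; 5; 5; 6; 0; 5; 6; 0; 0; 2; 2; 5; 5];
  [:: 0; 5; 2; 2; 5; 2; 2; 2; 2; 2; 2; 4; 2; 2; 4; 1];
  [:: 0; 5; 2; 2; 5; 2; 2; 2; 2; 2; 2; 4; 2; 2; 4; 1];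
  [:: 0; 5; 2; 2; 5; 2; 2; 2; 2; 2; 2; 2; 2; 2; 2; 2]].

Definition shift3 (a b : nat) : nat := (b + 3 - a) %% 3.

Definition defect (a b : nat) : bool := b != a.+1 %% 3.

(** The vertex at the upper right corner of a 5 x 5 window [p] of phases.  The
    four corners of the window give the phases of the quadrants, continued to
    the position of the vertex; [i] and [j] are the distances to the lines of
    discontinuity, 4 if the window shows none. *)
Definition fill (p : nat -> nat -> nat) : nat :=
  let ll := (p 0 0 + 8) %% 3 in
  let rl := (p 4 0 + 4) %% 3 in
  let lu := (p 0 4 + 4) %% 3 in
  let ru := p 4 4 in
  let i := find (fun k => defect (p (3 - k) 0) (p (4 - k) 0)
                       || defect (p (3 - k) 4) (p (4 - k) 4)) (iota 0 4) in
  let j := find (fun k => defect (p 0 (3 - k)) (p 0 (4 - k))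
                       || defect (p 4 (3 - k)) (p 4 (4 - k))) (iota 0 4) in
  if j == 4 then
    if i == 4 then ru else rot7 lu (nth 0 (nth [::] wall (shift3 lu ru)) i)
  else if i == 4 then rot7 rl (nth 0 (nth [::] wall (shift3 rl ru)) j)
  else rot7 ll (nth 0 (nth [::] junction
         (9 * shift3 ll rl + 3 * shift3 ll lu + shift3 ll ru)) (4 * i + j)).

(** A 6 x 6 window with phases given at its four corners, and with the lines
    after column [cx] and row [cy]; the value 5 stands for no line. *)
Definition quad (ll rl lu ru cx cy i j : nat) : nat :=
  if i <= cx then (if j <= cy then (ll + i + j) %% 3 else (lu + i + j + 1) %% 3)
  else (if j <= cy then (rl + i + 1 + j) %% 3 else (ru + i + 1 + j + 1) %% 3).

Definition fill_ok (ll rl lu ru cx cy : nat) : bool :=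
  let p := quad ll rl lu ru cx cy in
  let v := fill p in
  [&& v < 7, arc7 v (fill (fun i j => p i.+1 j)) & arc7 v (fill (fun i j => p i j.+1))].

Lemma fill_okP : all (fun ll => all (fun rl => all (fun lu => all (fun ru =>
  all (fun cx => all (fun cy => fill_ok ll rl lu ru cx cy) (iota 0 6)) (iota 0 6))
  (iota 0 3)) (iota 0 3)) (iota 0 3)) (iota 0 3).
Proof. vm_compute. reflexivity. Qed.

Lemma fill_quad ll rl lu ru cx cy :
  (ll < 3)%N -> (rl < 3)%N -> (lu < 3)%N -> (ru < 3)%N -> (cx < 6)%N -> (cy < 6)%N ->
  fill_ok ll rl lu ru cx cy.
Proof.
move=> h1 h2 h3 h4 h5 h6; have := fill_okP.
move=> /allP /(_ ll); rewrite mem_iota h1 => /(_ isT).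
move=> /allP /(_ rl); rewrite mem_iota h2 => /(_ isT).
move=> /allP /(_ lu); rewrite mem_iota h3 => /(_ isT).
move=> /allP /(_ ru); rewrite mem_iota h4 => /(_ isT).
move=> /allP /(_ cx); rewrite mem_iota h5 => /(_ isT).
by move=> /allP /(_ cy); rewrite mem_iota h6 => /(_ isT).
Qed.

Lemma eq_fill p q : (forall i j, (i <= 4)%N -> (j <= 4)%N -> p i j = q i j) -> fill p = fill q.
Proof. by move=> E; rewrite /fill /= !E. Qed.

End SevenVertices.

Section Quadrants.
Variable P : nat -> nat -> nat.
Hypothesis P3 : forall i j, (P i j < 3)%N.

Lemma step_chain (u : nat -> nat) (c : nat) :
  (forall i, u i < 3)%N ->
  (forall i, (i < 5)%N -> defect (u i) (u i.+1) -> i = c) ->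
  forall i, (i <= 5)%N -> u i = (if (i <= c)%N then (u 0 + i) %% 3 else (u 5 + i + 1) %% 3)%N.
Proof.
move=> u3 uc.
have S i : (i < 5)%N -> i != c -> u i.+1 = ((u i).+1 %% 3)%N.
  move=> i5 ic; apply/eqP; apply: contraNT ic => H; apply/eqP; exact: uc.
have u5 := u3 5%N; have u0 := u3 0%N.
have up i : (i <= 5)%N -> (i <= c)%N -> u i = ((u 0 + i) %% 3)%N.
  by elim: i => [|i IH] i5 ic; [|rewrite S ?IH]; lia.
have down m : (m <= 5)%N -> (c < 5 - m)%N -> u (5 - m)%N = ((u 5 + (5 - m) + 1) %% 3)%N.
  elim: m => [|m IH] m5 mc; first by rewrite subn0; lia.
  have := S (5 - m.+1)%N; have -> : (5 - m.+1).+1 = (5 - m)%N by lia.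
  rewrite IH; try lia.
  by move=> /(_ ltac:(lia) ltac:(lia)); have := u3 (5 - m.+1)%N; lia.
move=> i i5; case: leqP => ic; first exact: up.
by have := down (5 - i)%N ltac:(lia) ltac:(lia); rewrite subKn.
Qed.

Hypothesis Ph : forall i j i' j', (i < 5)%N -> (j <= 5)%N -> (i' < 5)%N -> (j' <= 5)%N ->
  defect (P i j) (P i.+1 j) -> defect (P i' j') (P i'.+1 j') -> i = i'.
Hypothesis Pv : forall i j i' j', (i <= 5)%N -> (j < 5)%N -> (i' <= 5)%N -> (j' < 5)%N ->
  defect (P i j) (P i j.+1) -> defect (P i' j') (P i' j'.+1) -> j = j'.

(** If all horizontal defects of a 6 x 6 window lie in one column and all
    vertical ones in one row, then each of the four quadrants is determined by
    its corner. *)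
Lemma quad_of_defects : exists cx cy, [/\ (cx < 6)%N, (cy < 6)%N &
  forall i j, (i <= 5)%N -> (j <= 5)%N ->
    P i j = quad (P 0 0) (P 5 0) (P 0 5) (P 5 5) cx cy i j].
Proof.
have [cx cx6 Hx] : exists2 cx, (cx < 6)%N & forall i j, (i < 5)%N -> (j <= 5)%N ->
    defect (P i j) (P i.+1 j) -> i = cx.
  have [[i [j [i5 j5 ij]]]|H] := pselect (exists i j, [/\ (i < 5)%N, (j <= 5)%N & defect (P i j) (P i.+1 j)]).
    exists i; first by lia.
    by move=> i' j' i'5 j'5 /Ph H; apply: (H i j).
  by exists 5%N => // i j i5 j5 D; case: H; exists i, j.
have [cy cy6 Hy] : exists2 cy, (cy < 6)%N & forall i j, (i <= 5)%N -> (j < 5)%N ->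
    defect (P i j) (P i j.+1) -> j = cy.
  have [[i [j [i5 j5 ij]]]|H] := pselect (exists i j, [/\ (i <= 5)%N, (j < 5)%N & defect (P i j) (P i j.+1)]).
    exists j; first by lia.
    by move=> i' j' i'5 j'5 /Pv H; apply: (H i j).
  by exists 5%N => // i j i5 j5 D; case: H; exists i, j.
exists cx, cy; split=> // i j i5 j5.
have Hi := step_chain (u := P^~ j) (fun k => P3 k j) (fun k k5 => @Hx k j k5 j5) i5.
have H0 := step_chain (u := P 0) (P3 0) (fun k k5 => @Hy 0%N k isT k5) j5.
have H5 := step_chain (u := P 5) (P3 5) (fun k k5 => @Hy 5%N k isT k5) j5.
by rewrite Hi H0 H5 /quad; clear; case: leqP => _; case: leqP => _; lia.
Qed.

End Quadrants.

(** * Squares around anchors and the colouring *)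

Lemma box_uniq N : uniq (box N).
Proof.
apply: allpairs_uniq; rewrite ?iota_uniq // => -[a b] [c d] _ _ /= [].
by move=> h1 h2; congr pair; lia.
Qed.

Lemma box_opp N d : d \in box N -> - d \in box N.
Proof. by rewrite !mem_box /in_box; case: d => a b /=; lia. Qed.

Lemma box_le M N d : (M <= N)%N -> d \in box M -> d \in box N.
Proof. by rewrite !mem_box /in_box; lia. Qed.

Lemma eq_divn_close (k a b : nat) : (a %/ k.+1 = b %/ k.+1 -> a <= b + k)%N.
Proof.
move=> E; rewrite (divn_eq a k.+1) (divn_eq b k.+1) E -addnA leq_add2l.
by rewrite (leq_trans _ (leq_addl _ _)) // -ltnS ltn_pmod.
Qed.

(** Points of a box that are pairwise more than [K] apart lie in different cells
    of a grid of mesh [K + 1]. *)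
Lemma packing (K L q : nat) (s : seq Zsq) :
  uniq s -> {subset s <= box L} -> ((L.*2) < q * K.+1)%N ->
  {in s &, forall d d', d - d' \in box K -> d = d'} -> (size s <= q * q)%N.
Proof.
move=> us sL Lq sep.
pose cell (d : Zsq) := ((absz (d.1 + L%:Z)%R %/ K.+1)%N, (absz (d.2 + L%:Z)%R %/ K.+1)%N).
have cell_inj : {in s &, injective cell}.
  move=> d d' ds d's [E1 E2]; apply: sep => //.
  move: (sL _ ds) (sL _ d's); rewrite !mem_box /in_box /= => d1 d2.
  move: (eq_divn_close E1) (eq_divn_close (esym E1)).
  move: (eq_divn_close E2) (eq_divn_close (esym E2)).
  by clear -d1 d2; lia.
rewrite -(size_map cell) -[X in (_ <= X * _)%N](size_iota 0 q) -[X in (_ <= _ * X)%N](size_iota 0 q).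
rewrite -(size_allpairs pair); apply: uniq_leq_size; first by rewrite map_inj_in_uniq.
move=> _ /mapP[d ds ->]; apply/allpairsP; exists (cell d); rewrite !mem_iota.
move: (sL _ ds); rewrite mem_box /in_box => dL; split=> //; rewrite add0n ltn_divLR //; lia.
Qed.

Section Colouring.
Variable K : nat.
(** A square has at most 10 * 10 anchors near it, and each of them excludes at
    most 88 of the [K] admissible radii. *)
Hypothesis K_big : (88 * (10 * 10) < K)%N.

(** Squares that meet the same 6 x 6 window have centres at most this far apart. *)
Definition reach : nat := 4 * K + 5.
Definition priority : X -> nat := pattern_code reach.

Lemma priority_neq d x : d \in box reach -> d != 0 -> priority (act d x) != priority x.
Proof. exact: pattern_code_neq. Qed.

Definition anchor : X -> bool := greedy priority (box K) (fun _ s => ~~ has snd s).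

Lemma local_anchor x : local_at anchor x.
Proof. by apply: local_greedy => [y|s y]; [exact: local_pattern_code|exact: local_at_const]. Qed.

Lemma anchorE x : anchor x = ~~ has (fun d => anchor (act d x)) (earlier priority (box K) x).
Proof. by rewrite {1}/anchor greedyE has_map. Qed.

Lemma anchor_sep d x : d \in box K -> anchor x -> anchor (act d x) -> d = 0.
Proof.
move=> dK ax ad; apply/eqP/negPn/negP => d0.
have dL : d \in box reach by apply: box_le dK; rewrite /reach; lia.
have := priority_neq x dL d0; rewrite neq_ltn => /orP[lt|lt].
  move: ax; rewrite anchorE => /hasPn /(_ d); rewrite ad mem_filter lt dK => /(_ erefl).
  by [].
move: ad; rewrite anchorE => /hasPn /(_ (- d)); rewrite mem_filter act_oppK lt ax box_opp //.
by move=> /(_ erefl).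
Qed.

Lemma anchor_max x : exists2 d, d \in box K & anchor (act d x).
Proof.
case ax : (anchor x); first by exists 0; rewrite ?act0 // mem_box.
move: ax; rewrite anchorE => /negbFE /hasP[d]; rewrite mem_filter => /andP[_ dK] ad.
by exists d.
Qed.

(** The lines of discontinuity that a square of radius [r] centred at 0 can
    cause in one coordinate: after its last and before its first column. *)
Definition sides (r : nat) : seq int := [:: r%:Z; - r%:Z - 1].

(** The squares of radius [r] at 0 and of radius [r'] at [d] have side lines at
    distance at most 5 in some coordinate, so that a 6 x 6 window could meet
    both. *)
Definition clash (d : Zsq) (r r' : nat) : bool :=
  has (fun s => has (fun t => (`|s - d.1 - t| <= 5) || (`|s - d.2 - t| <= 5)) (sides r'))
      (sides r).

Definition forbidden (d : Zsq) (r' : nat) : seq nat :=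
  let zs : seq int := [:: d.1 + r'%:Z; d.2 + r'%:Z; d.1 - r'%:Z - 1; d.2 - r'%:Z - 1] in
  [seq absz (z + e%:Z - 5)%R | z : int <- zs, e : nat <- iota 0 11] ++
  [seq absz (- (z + e%:Z - 5) - 1)%R | z : int <- zs, e : nat <- iota 0 11].

Lemma size_forbidden d r' : size (forbidden d r') = 88.
Proof. by rewrite size_cat !size_allpairs size_iota. Qed.

Lemma clash_forbidden d r r' : clash d r r' -> r \in forbidden d r'.
Proof.
pose zs : seq int := [:: d.1 + r'%:Z; d.2 + r'%:Z; d.1 - r'%:Z - 1; d.2 - r'%:Z - 1].
have H (z e : int) : z \in zs -> `|e| <= 5 ->
    (r%:Z = z + e -> r \in forbidden d r') /\ (- r%:Z - 1 = z + e -> r \in forbidden d r').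
  move=> zz e5; rewrite /forbidden -/zs; split=> E; rewrite mem_cat; apply/orP; [left|right];
  by apply/allpairsP; exists (z, absz (e + 5)); rewrite mem_iota /=; split=> //; lia.
have z1 : d.1 + r'%:Z \in zs by rewrite !inE eqxx ?orbT.
have z2 : d.2 + r'%:Z \in zs by rewrite !inE eqxx ?orbT.
have z3 : d.1 - r'%:Z - 1 \in zs by rewrite !inE eqxx ?orbT.
have z4 : d.2 - r'%:Z - 1 \in zs by rewrite !inE eqxx ?orbT.
move: (forbidden d r') H => F H.
case/hasP => s; rewrite !inE => /orP[] /eqP -> /hasP[t]; rewrite !inE => /orP[] /eqP -> /orP[] E.
- by apply: (H _ _ z1 E).1; lia.
- by apply: (H _ _ z2 E).1; lia.
- by apply: (H _ _ z3 E).1; lia.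
- by apply: (H _ _ z4 E).1; lia.
- by apply: (H _ _ z1 E).2; lia.
- by apply: (H _ _ z2 E).2; lia.
- by apply: (H _ _ z3 E).2; lia.
- by apply: (H _ _ z4 E).2; lia.
Qed.

Lemma clash_sym d r r' : clash (- d) r' r = clash d r r'.
Proof.
have W e k k' : clash e k k' -> clash (- e) k' k.
  case/hasP => s sk /hasP[t tk H]; apply/hasP; exists t => //; apply/hasP; exists s => //.
  by move: H; case: e => a b /=; clear; lia.
by apply/idP/idP => /W //; rewrite opprK.
Qed.

Definition admissible (s : seq (Zsq * nat)) (r : nat) : bool :=
  all (fun e => (0 < e.2)%N ==> ~~ clash e.1 r e.2) s.

Definition choose_radius (x : X) (s : seq (Zsq * nat)) : nat :=
  if anchor x then head 0%N [seq r <- iota K K | admissible s r] else 0%N.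

(** Radii are chosen greedily between [K] and [2 K]; the radius 0 marks the points
    that are not anchors. *)
Definition radius : X -> nat := greedy priority (box reach) choose_radius.

Lemma local_radius x : local_at radius x.
Proof.
apply: local_greedy => [y|s y]; first exact: local_pattern_code.
by apply: (local_at_comp (fun b : bool => if b then _ else _)); exact: local_anchor.
Qed.

Lemma radius0 x : (0 < radius x)%N -> anchor x.
Proof. by rewrite /radius greedyE /choose_radius; case: (anchor x). Qed.

(** The [K] candidates outnumber the radii forbidden by earlier anchors, because
    the number of anchors in a box is bounded by [packing]. *)
Lemma exists_admissible x : anchor x ->
  has (admissible [seq (d, radius (act d x)) | d <- earlier priority (box reach) x]) (iota K K).
Proof.
move=> ax; set s := [seq _ | d <- _]; apply/negPn/negP => /hasPn H.
pose s' := [seq d <- earlier priority (box reach) x | (0 < radius (act d x))%N].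
have sub : {subset iota K K <= flatten [seq forbidden d (radius (act d x)) | d <- s']}.
  move=> r /H /allPn[_ /mapP[d dx ->]] /=; rewrite negb_imply negbK => /andP[r0 cl].
  apply/flattenP; exists (forbidden d (radius (act d x))); last exact: clash_forbidden.
  by apply: map_f; rewrite mem_filter r0.
have := uniq_leq_size (iota_uniq K K) sub; rewrite size_iota.
have -> : size (flatten [seq forbidden d (radius (act d x)) | d <- s']) = (88 * size s')%N.
  rewrite size_flatten -(size_map (fun d => forbidden d (radius (act d x)))).
  have : all (fun t => size t == 88) [seq forbidden d (radius (act d x)) | d <- s'].
    by apply/allP => _ /mapP[d _ ->]; rewrite size_forbidden.
  move: [seq _ | _ <- _]; elim=> //= t ss IH /andP[/eqP -> /IH ->].
  by rewrite mulnS.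
have : (size s' <= 10 * 10)%N.
  apply: (@packing K reach); rewrite ?filter_uniq ?box_uniq //.
  - by move=> d; rewrite !mem_filter => /and3P[].
  - by rewrite /reach; lia.
  move=> d d'; rewrite !mem_filter => /and3P[/radius0 ad _ dL] /and3P[/radius0 ad' _ d'reach] dd'.
  apply/eqP; rewrite -subr_eq0; apply/eqP.
  by apply: (anchor_sep (x := act d' x)) => //; rewrite -actD subrK.
by move: K_big; lia.
Qed.

Lemma radius_spec x : anchor x ->
  (K <= radius x < K + K)%N /\
  admissible [seq (d, radius (act d x)) | d <- earlier priority (box reach) x] (radius x).
Proof.
move=> ax; rewrite {1 2 4}/radius !greedyE -/radius /choose_radius ax.
have := exists_admissible ax; set P := admissible _; rewrite has_filter.
case E : [seq r <- iota K K | P r] => [//|r t] _ /=.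
have : r \in [seq r <- iota K K | P r] by rewrite E mem_head.
by rewrite mem_filter mem_iota => /andP[-> ->].
Qed.

Lemma radius_sep d x : anchor x -> anchor (act d x) -> d \in box reach -> d != 0 ->
  ~~ clash d (radius x) (radius (act d x)).
Proof.
move=> ax ad dL d0.
have W e y : anchor y -> anchor (act e y) -> e \in box reach -> (priority (act e y) < priority y)%N ->
    ~~ clash e (radius y) (radius (act e y)).
  move=> ay ae eL lt; have [_ /allP H] := radius_spec ay.
  have me : (e, radius (act e y)) \in [seq (d, radius (act d y)) | d <- earlier priority (box reach) y].
    by apply/mapP; exists e; rewrite ?mem_filter ?lt.
  have /implyP := H _ me; apply; have [/andP[re _] _] := radius_spec ae.
  by apply: leq_trans re; move: K_big; lia.
have := priority_neq x dL d0; rewrite neq_ltn => /orP[lt|lt]; first exact: W.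
rewrite -clash_sym -{2}(act_oppK d x).
by apply: W; rewrite ?act_oppK ?box_opp.
Qed.

Definition covers (d : Zsq) (x : X) : bool :=
  anchor (act d x) && (norm d <= radius (act d x))%N.

Definition owns (d : Zsq) (x : X) : bool :=
  covers d x &&
  all (fun e => covers e x ==> (priority (act d x) <= priority (act e x))%N) (box (2 * K)).

(** The displacement from [x] to the anchor of least priority value among those
    whose squares cover [x].  The default 0 is never used. *)
Definition owner (x : X) : Zsq := head 0 [seq d <- box (2 * K) | owns d x].

Lemma local_covers d x : local_at (covers d) x.
Proof.
apply: (local_at_comp2 andb); first by apply: local_at_act; exact: local_anchor.
by apply: (local_at_comp (fun r => (_ <= r)%N)); apply: local_at_act; exact: local_radius.
Qed.

Lemma local_owner x : local_at owner x.
Proof.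
apply: (local_at_comp (head 0)); apply: local_at_filter => d _.
apply: (local_at_comp2 andb); first exact: local_covers.
apply: local_at_all => e _; apply: (local_at_comp2 implb); first exact: local_covers.
by apply: (local_at_comp2 (fun a b => (a <= b)%N)); apply: local_at_act; exact: local_pattern_code.
Qed.

Lemma covers_box d x : covers d x -> d \in box (2 * K).
Proof.
move=> /andP[/radius_spec[+ _] H]; rewrite mem_box /in_box; move: H; rewrite /norm; lia.
Qed.

Lemma ownerP x : covers (owner x) x /\
  forall e, covers e x -> (priority (act (owner x) x) <= priority (act e x))%N.
Proof.
have [d0 d0K ad0] := anchor_max x.
have cd0 : covers d0 x.
  rewrite /covers ad0; have [+ _] := radius_spec ad0.
  by move: d0K; rewrite mem_box /in_box /norm; lia.
have Ex : exists n, has (fun d => covers d x && (priority (act d x) == n)) (box (2 * K)).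
  by exists (priority (act d0 x)); apply/hasP; exists d0; rewrite ?cd0 ?eqxx // (covers_box cd0).
have [n /hasP[d dK /andP[cd /eqP pd]] nmin] := find_ex_minn Ex.
have sd : owns d x.
  rewrite /owns cd; apply/allP => e eK; apply/implyP => ce.
  by rewrite pd; apply: nmin; apply/hasP; exists e; rewrite ?ce ?eqxx.
rewrite /owner; case E : [seq d <- box (2 * K) | owns d x] => [|e t] /=.
  have : d \in [seq d <- box (2 * K) | owns d x] by rewrite mem_filter sd.
  by rewrite E.
have : e \in [seq d <- box (2 * K) | owns d x] by rewrite E mem_head.
rewrite mem_filter => /andP[/andP[ce /allP H] _]; split=> // f cf.
by have /implyP := H f (covers_box cf); apply.
Qed.

(** The 3-cycle phase at [x], counted from the owner of [x]. *)
Definition phase (x : X) : nat := absz ((- ((owner x).1 + (owner x).2)) %% 3)%Z.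

Lemma local_phase x : local_at phase x.
Proof. by apply: (local_at_comp (fun d : Zsq => absz ((- (d.1 + d.2)) %% 3)%Z)); exact: local_owner. Qed.

Lemma phase_lt3 x : (phase x < 3)%N.
Proof. by rewrite /phase; lia. Qed.

Definition unit (k : bool) : Zsq := if k then e1 else e2.
Definition coord (k : bool) (h : Zsq) : int := if k then h.1 else h.2.

(** If the phase does not advance from [w] to its neighbour, then the two points
    have different owners, and by minimality one of the two squares covers only
    one of the two points: its side line runs between them. *)
Lemma phase_defect k x w :
  defect (phase (act w x)) (phase (act (unit k + w) x)) ->
  exists a s, [/\ anchor (act a x), s \in sides (radius (act a x)),
                  a - w \in box (2 * K) & coord k w = coord k a + s].
Proof.
move=> D; set y := act w x in D; set z := act (unit k + w) x in D.
have zE : z = act (unit k) y by rewrite /z /y actD.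
have [cy my] := ownerP y; have [cz mz] := ownerP z.
set d := owner y in cy my; set d' := owner z in cz mz.
have dd' : d != d' + unit k.
  apply: contraL D => /eqP E; rewrite /defect negbK /phase -/d -/d' E.
  by rewrite /unit /e1 /e2; case: (k); case: (d') => a b /=; clear; lia.
have az e : act e z = act (e + unit k) y by rewrite zE actD.
case/andP: (cy) => ay ny; case/andP: (cz); rewrite az => az' nz.
have [/andP[_ ry] _] := radius_spec ay.
have [/andP[_ rz] _] := radius_spec az'.
have [E|nE] := boolP (norm (d - unit k) <= radius (act d y))%N; last first.
  exists (d + w), (radius (act d y))%:Z; rewrite actD -/y ay addrK mem_head.
  move: nE ny ry; rewrite mem_box /in_box /norm /unit /coord.
  by move: (radius _) => r; case: (k); case: (d) => a b; case: (w) => a' b' /=; clear; split=> //; lia.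
have [E'|nE'] := boolP (norm (d' + unit k) <= radius (act (d' + unit k) y))%N; last first.
  exists (d' + unit k + w), (- (radius (act (d' + unit k) y))%:Z - 1).
  rewrite actD -/y az' addrK; split=> //; first by rewrite !inE eqxx orbT.
    move: nE' nz rz; rewrite mem_box /in_box /norm /unit /coord.
    by move: (radius _) => r; case: (k); case: (d') => a b /=; clear; lia.
  move: nE' nz rz; rewrite /norm /unit /coord.
  by move: (radius _) => r; case: (k); case: (d') => a b; case: (w) => a' b' /=; clear; lia.
have p1 : (priority (act d' z) <= priority (act d y))%N.
  have -> : act d y = act (d - unit k) z by rewrite az subrK.
  by apply: mz; rewrite /covers az subrK ay.
have p2 : (priority (act d y) <= priority (act d' z))%N.
  by rewrite az; apply: my; rewrite /covers az'.
have e0 : d' + unit k - d != 0 by rewrite subr_eq0 eq_sym.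
have eL : d' + unit k - d \in box reach.
  move: ny nz ry rz; rewrite mem_box /in_box /norm /reach /unit.
  move: (radius _) (radius _) => r r'.
  by case: (k); case: (d') => a b; case: (d) => a' b' /=; clear; lia.
have := priority_neq (act d y) eL e0; rewrite -actD subrK -az => /eqP[].
by apply/eqP; rewrite eqn_leq p1 p2.
Qed.

(** All defects of one direction in a 6 x 6 window lie on one line: the lines of
    two different squares are kept apart by [radius_sep], and the two lines of
    one square by its size. *)
Lemma same_line k x w w' :
  (forall c, `|coord c w - coord c w'| <= 5) ->
  defect (phase (act w x)) (phase (act (unit k + w) x)) ->
  defect (phase (act w' x)) (phase (act (unit k + w') x)) ->
  coord k w = coord k w'.
Proof.
move=> ww /phase_defect[a [s [aa sa aw E]]] /phase_defect[a' [s' [aa' sa' aw' E']]].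
have := ww k; rewrite E E' => close.
have [aE|na] := eqVneq a' a.
  rewrite aE in E' sa' close *; move: sa sa' close.
  have [/andP[+ _] _] := radius_spec aa.
  rewrite !inE; move: (radius _) K_big => r; clear=> K_big rK /orP[]/eqP-> /orP[]/eqP->; lia.
have L0 : a' - a \in box reach.
  move: aw aw' (ww true) (ww false); rewrite !mem_box /in_box /reach /coord.
  by case: (a) => ? ?; case: (a') => ? ?; case: (w) => ? ?; case: (w') => ? ? /=; clear; lia.
have a'E : act a' x = act (a' - a) (act a x) by rewrite -actD subrK.
have := radius_sep aa (_ : anchor (act (a' - a) (act a x))) L0.
rewrite -a'E subr_eq0 => /(_ aa' na) /hasPn /(_ s sa) /hasPn /(_ s' sa').
by move: close; rewrite /coord; case: (k); case: (a) => ? ?; case: (a') => ? ? /=; clear; lia.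
Qed.

Definition colour (x : X) : nat :=
  fill (fun i j => phase (act (i%:Z - 4, j%:Z - 4) x)).

Lemma local_colour x : local_at colour x.
Proof.
have [w wE] : exists w, w = [seq ((i, j) : nat * nat) | i <- iota 0 5, j <- iota 0 5] by eexists.
pose tab y := [seq phase (act ((ij.1%:Z - 4, ij.2%:Z - 4) : Zsq) y) | ij <- w].
have lt : local_at tab x.
  by apply: local_at_map => ij _; apply: local_at_act; exact: local_phase.
pose read (t : seq nat) := fill (fun i j => nth 0%N t (index (i, j) w)).
have -> : colour = fun y => read (tab y).
  apply/funext => y; apply: eq_fill => i j i4 j4.
  have ijw : (i, j) \in w.
    by rewrite wE; apply/allpairsP; exists (i, j); rewrite !mem_iota.
  rewrite /tab (nth_map (0, 0)%N); last by rewrite index_mem.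
  by rewrite (nth_index _ ijw).
exact: local_at_comp.
Qed.

Lemma colour_ok x : [&& (colour x < 7)%N, arc7 (colour x) (colour (act e1 x)) &
  arc7 (colour x) (colour (act e2 x))].
Proof.
pose x0 := act (- 4, - 4) x.
pose P (i j : nat) := phase (act (i%:Z, j%:Z) x0).
have C0 : colour x = fill P.
  by apply: eq_fill => i j _ _; rewrite /P /x0 -actD.
have C1 : colour (act e1 x) = fill (fun i j => P i.+1 j).
  apply: eq_fill => i j _ _; rewrite /P /x0 -!actD; congr (phase (act _ x)).
  by rewrite /e1; apply: Zsq_ext => /=; lia.
have C2 : colour (act e2 x) = fill (fun i j => P i j.+1).
  apply: eq_fill => i j _ _; rewrite /P /x0 -!actD; congr (phase (act _ x)).
  by rewrite /e2; apply: Zsq_ext => /=; lia.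
have P3 i j : (P i j < 3)%N by exact: phase_lt3.
have e1E (i j : nat) : ((i.+1%:Z, j%:Z) : Zsq) = unit true + (i%:Z, j%:Z).
  by rewrite /unit /e1; apply: Zsq_ext => /=; lia.
have e2E (i j : nat) : ((i%:Z, j.+1%:Z) : Zsq) = unit false + (i%:Z, j%:Z).
  by rewrite /unit /e2; apply: Zsq_ext => /=; lia.
have Ph i j i' j' : (i < 5)%N -> (j <= 5)%N -> (i' < 5)%N -> (j' <= 5)%N ->
  defect (P i j) (P i.+1 j) -> defect (P i' j') (P i'.+1 j') -> i = i'.
  rewrite /P !e1E => h1 h2 h3 h4 D D'.
  have cl c : `|coord c (i%:Z, j%:Z) - coord c (i'%:Z, j'%:Z)| <= 5.
    by case: c; rewrite /coord /=; lia.
  by have := same_line cl D D'; rewrite /coord /=; lia.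
have Pv i j i' j' : (i <= 5)%N -> (j < 5)%N -> (i' <= 5)%N -> (j' < 5)%N ->
  defect (P i j) (P i j.+1) -> defect (P i' j') (P i' j'.+1) -> j = j'.
  rewrite /P !e2E => h1 h2 h3 h4 D D'.
  have cl c : `|coord c (i%:Z, j%:Z) - coord c (i'%:Z, j'%:Z)| <= 5.
    by case: c; rewrite /coord /=; lia.
  by have := same_line cl D D'; rewrite /coord /=; lia.
have [cx [cy [cx6 cy6 E]]] := quad_of_defects P3 Ph Pv.
have := fill_quad (P3 0 0)%N (P3 5 0)%N (P3 0 5)%N (P3 5 5)%N cx6 cy6.
have D0 := etrans C0 (eq_fill (fun i j i4 j4 => E i j (leqW i4) (leqW j4))).
have D1 := etrans C1 (eq_fill (fun i j (i4 : (i <= 4)%N) j4 => E i.+1 j i4 (leqW j4))).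
have D2 := etrans C2 (eq_fill (fun i j i4 (j4 : (j <= 4)%N) => E i j.+1 (leqW i4) j4)).
by rewrite /fill_ok -D0 -D1 -D2.
Qed.

End Colouring.

Definition digraph7 : digraph 'I_7.
Proof.
refine (@Digraph _ (fun a b : 'I_7 => arc7 a b) _).
by move=> a; case: a; do 7?[case=> //].
Defined.

Definition oriented7 : oriented_graph 'I_7.
Proof.
refine (@OrientedGraph _ digraph7 _) => a b /=.
by case: a; do 7?[case=> //] => ?; case: b; do 7?[case=> //].
Defined.

Theorem seven_suffice : has_continuous_hom_of_size schreier_graph 7.
Proof.
have [K K_big] : exists K, (88 * (10 * 10) < K)%N by eexists; exact: ltnSn.
have ok x := and3P (colour_ok K_big x).
have [f lf fE] : exists2 f : X -> 'I_7, local f & forall x, f x = colour K x :> nat.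
  exists (fun x => inord (colour K x)).
    by move=> x; exact: (local_at_comp (f := colour K) (@inord 6) (local_colour K x)).
  by move=> x; rewrite inordK //; case: (ok x).
exists 'I_7, oriented7, f; split; first by rewrite card_ord.
  exact/continuous_local.
move=> x y /schreier_arcP[] ->; case: (ok x) => _; rewrite -(fE x) -(fE (act _ x)) -(fE (act _ x)).
  by move=> h _; exact: h.
by move=> _ h; exact: h.
Qed.

(** * A point of the free part with wide periodic strips *)

(** The period-doubling sequence: the parity of the 2-adic valuation. *)
Definition toeplitz (m : int) : bool := odd (logn 2 `|m|%N).

Lemma logn2_mul_odd (a : nat) (r : int) :
  odd `|r|%N -> logn 2 (absz ((2 ^ a)%N%:Z * r)%R) = a.
Proof.
move=> or; rewrite abszM absz_nat lognM ?expn_gt0 //; last by case: `|r|%N or.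
by rewrite pfactorK // logn_coprime ?addn0 // coprime2n.
Qed.

(** No shift [g] preserves the sequence, and this shows in every interval of
    bounded length: for [g = 2^a o] with [o] odd, look at an odd multiple of
    [2^a] whose translate by [g] is twice an odd multiple of [2^a].  Such
    points occur in every interval of length [2^(a+2)]. *)
Lemma toeplitz_break (g : int) : g != 0 -> exists T : nat, forall m : int,
  exists2 s : nat, (s < T)%N & toeplitz (m + s%:Z) != toeplitz (m + s%:Z + g).
Proof.
move=> g0; have g0' : (0 < `|g|)%N by rewrite absz_gt0.
pose a := logn 2 `|g|%N; have [c co gc] := pfactor_coprime (isT : prime 2) g0'.
rewrite -/a in gc; rewrite coprime2n in co.
have [o oo go] : exists2 o : int, odd `|o|%N & g = (2 ^ a)%N%:Z * o.
  have [gp|gn] := lerP 0 g.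
    by exists c%:Z => //; rewrite -[LHS](gez0_abs gp) gc PoszM mulrC.
  by exists (- c%:Z); rewrite ?abszN // mulrN mulrC -PoszM -gc; lia.
exists (2 ^ a * 4)%N => m.
pose M : int := (2 ^ a * 4)%N%:Z.
have M0 : M != 0 by rewrite /M eqz_nat muln_eq0 expn_eq0.
pose s := absz (((2 ^ a)%N%:Z * (2 - o) - m) %% M)%Z.
have sE : s%:Z = (((2 ^ a)%N%:Z * (2 - o) - m) %% M)%Z by rewrite /s gez0_abs // modz_ge0.
exists s.
  by rewrite -ltz_nat sE; apply: ltz_pmod; rewrite /M ltz_nat muln_gt0 expn_gt0.
have := divz_eq ((2 ^ a)%N%:Z * (2 - o) - m) M; move: (_ %/ _)%Z => q; rewrite -sE => E.
have E1 : m + s%:Z = (2 ^ a)%N%:Z * (2 - o - 4 * q).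
  have -> : m + s%:Z = (2 ^ a)%N%:Z * (2 - o) - q * M by move: E; clear; lia.
  by rewrite /M PoszM; lia.
have E2 : m + s%:Z + g = (2 ^ a.+1)%N%:Z * (1 - 2 * q).
  by rewrite E1 go expnS PoszM; lia.
rewrite /toeplitz E2 E1 !logn2_mul_odd ?oddS //; lia.
Qed.

Definition column_period (i : int) : nat := (trunc_log 2 `|i|).+1.

(** The even columns carry the period-doubling sequence horizontally.  Odd
    column number [i] carries, vertically, the periodic repetition of an initial
    segment of it; the period grows with [i] but is constant on long ranges
    of columns, and consecutive ranges have consecutive periods. *)
Definition stripes : shift_space := fun h =>
  let i := (h.1 %/ 2)%Z in
  if (h.1 %% 2)%Z == 0 then toeplitz i else toeplitz (h.2 %% (column_period i)%:Z)%Z.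

Lemma stripes_even (i j : int) : stripes (2 * i, j) = toeplitz i.
Proof.
rewrite /stripes /=; have -> : (2 * i %% 2)%Z = 0 by lia.
by have -> : (2 * i %/ 2)%Z = i by lia.
Qed.

Lemma stripes_odd (i j : int) :
  stripes (2 * i + 1, j) = toeplitz (j %% (column_period i)%:Z)%Z.
Proof.
rewrite /stripes /=; have -> : ((2 * i + 1) %% 2)%Z = 1 by lia.
by have -> : ((2 * i + 1) %/ 2)%Z = i by lia.
Qed.

Lemma column_period_ge (B : nat) (i : int) : (2 ^ B <= `|i|)%N -> (B < column_period i)%N.
Proof.
move=> H; rewrite /column_period ltnS; apply: trunc_log_max => //.
Qed.

(** [g] visibly moves [stripes] near every point; this passes to all limits of
    translates of [stripes]. *)
Definition breaks (g : Zsq) := exists T : nat, forall v : Zsq,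
  exists2 t : Zsq, in_box T t & stripes (v + t) != stripes (v + t + g).

Lemma breaks_horizontal (m n : int) : m != 0 -> breaks (2 * m, n).
Proof.
move=> /toeplitz_break[T H]; exists (2 * T + 2)%N => -[v1 v2].
have [s sT Hs] := H ((v1 %/ 2)%Z + 1).
exists (2 * ((v1 %/ 2)%Z + 1 + s%:Z) - v1, 0).
  by rewrite /in_box /=; lia.
have -> : (v1, v2) + (2 * ((v1 %/ 2)%Z + 1 + s%:Z) - v1, 0) = (2 * ((v1 %/ 2)%Z + 1 + s%:Z), v2).
  by apply: Zsq_ext => /=; lia.
have -> : (2 * ((v1 %/ 2)%Z + 1 + s%:Z), v2) + (2 * m, n) = (2 * ((v1 %/ 2)%Z + 1 + s%:Z + m), v2 + n).
  by apply: Zsq_ext => /=; lia.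
by rewrite !stripes_even.
Qed.

(** Near any point there is a column whose period exceeds a bound depending only
    on [n]; in such a column a whole interval and its translate by [n] fit into
    one period, and there the sequence is the period-doubling one. *)
Lemma breaks_vertical (n : int) : n != 0 -> breaks (0, n).
Proof.
move=> /toeplitz_break[T H]; pose B := (2 * `|n|%N + T)%N.
exists (4 * 2 ^ B + 3 * B + 4)%N => -[v1 v2].
pose i : int := if (2 ^ B <= `|(v1 %/ 2)%Z|)%N then (v1 %/ 2)%Z else (2 ^ B)%N%:Z.
have iB : (2 ^ B <= `|i|)%N by rewrite /i; case: ifP.
have i_near : `|2 * i + 1 - v1| <= (4 * 2 ^ B + 4)%N%:Z.
  by rewrite /i; case: ifP; clear; lia.
have := column_period_ge iB; set p := column_period i => pB.
have p0 : p%:Z != 0 by lia.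
set r0 := (v2 %% p%:Z)%Z.
have r0_ge0 : 0 <= r0 by apply: modz_ge0.
have r0_lt : r0 < p%:Z by apply: ltz_pmod; lia.
have v2E : v2 = (v2 %/ p%:Z)%Z * p%:Z + r0 by exact: divz_eq.
(* A height [v2 + k] near [v2] whose position [c] in the period leaves room for
   [T] steps and for the shift by [n]. *)
have [c [k [cE [c_ge c_lt] v2c]]] : exists c k : int, [/\ v2 + k = c %[mod p%:Z]%Z,
    `|n| <= c /\ c + `|n| + T%:Z <= p%:Z & `|k| <= (B + B)%N%:Z].
  have [fits|] := lerP (r0 + 2 * `|n| + T%:Z) p%:Z.
    exists (r0 + `|n|), `|n|; split; last by rewrite /B; lia.
      by rewrite {1}v2E -addrA modzMDl.
    by split; lia.
  move=> over; exists `|n|, (p%:Z - r0 + `|n|); split; last by move: pB over r0_lt; rewrite /B; lia.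
    have -> : v2 + (p%:Z - r0 + `|n|) = ((v2 %/ p%:Z)%Z + 1) * p%:Z + `|n|.
      by rewrite mulrDl mul1r; move: v2E; move: (_ * p%:Z); lia.
    by rewrite modzMDl.
  by split; move: pB; rewrite /B; lia.
have [s sT Hs] := H c.
exists (2 * i + 1 - v1, k + s%:Z).
  by move: i_near v2c sT; rewrite /in_box /B /=; clear; lia.
have E : (v1, v2) + (2 * i + 1 - v1, k + s%:Z) = (2 * i + 1, v2 + (k + s%:Z)).
  by apply: Zsq_ext => /=; clear; lia.
rewrite E (_ : _ + (0, n) = (2 * i + 1, v2 + k + (s%:Z + n))); last first.
  by apply: Zsq_ext => /=; clear; lia.
rewrite !stripes_odd -/p addrA -(modzDml (v2 + k) s%:Z) -(modzDml (v2 + k) (s%:Z + n)) cE !modzDml.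
rewrite addrA !modz_small //; move: c_ge c_lt sT; clear; lia.
Qed.

Lemma breaksP (g : Zsq) : g != 0 -> breaks g.
Proof.
have even h : h != 0 -> breaks (2 * h.1, h.2).
  case: h => m n; rewrite [fst _]/= [snd _]/= => h0.
  have [m0|] := eqVneq m 0; last exact: breaks_horizontal.
  rewrite m0 mulr0; apply: breaks_vertical; apply: contraNneq h0 => ->.
  by rewrite m0.
case: g => a b g0; have [H|H] := eqVneq (a %% 2)%Z 0.
  have aE : a = 2 * (a %/ 2)%Z by lia.
  rewrite aE; apply: (even ((a %/ 2)%Z, b)); apply: contra_neq g0 => -[a0 ->].
  by rewrite aE a0.
have /even[T HT] : ((a, 2 * b) : Zsq) != 0.
  by apply: contra_neq g0 => -[a0 _]; move: H; rewrite a0.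
exists (T + `|a| + `|b|)%N => v; have [t tT Ht] := HT v.
have gg : v + t + (2 * a, 2 * b) = v + (t + (a, b)) + (a, b).
  by apply: Zsq_ext => /=; clear; lia.
have [E|] := eqVneq (stripes (v + t)) (stripes (v + t + (a, b))); last first.
  by exists t => //; move: tT; rewrite /in_box; lia.
exists (t + (a, b)); first by move: tT; rewrite /in_box /=; lia.
by move: Ht; rewrite E gg addrA.
Qed.

Lemma free_stripes : free_part stripes.
Proof.
move=> g /eqP/breaksP[T HT] E; have [t _ /eqP[]] := HT 0.
by rewrite -{1}E.
Qed.

Definition base : X := exist _ stripes (mem_set free_stripes).

Section Compactness.
Local Open Scope classical_set_scope.

(** Otherwise there are, for every [N], two translates of [stripes] that agree on
    the window of size [N] but have different values.  A limit point [y] of the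
    first ones is in the free part by [breaksP], and [f] is constant on a window
    around [y], which contains both translates for large [N]. *)
Lemma uniform_window (V : Type) (f : X -> V) : local f ->
  exists N, forall h h', agree N (shift h stripes) (shift h' stripes) ->
    f (act h base) = f (act h' base).
Proof.
move=> lf; apply: contrapT => nex; have bad N : exists hh : Zsq * Zsq, agree N (shift hh.1 stripes) (shift hh.2 stripes) /\
    f (act hh.1 base) <> f (act hh.2 base).
  apply: contrapT => nb; apply: nex; exists N => h h' hh'; apply: contrapT => fhh'.
  by apply: nb; exists (h, h').
have [hh Hhh] := choice bad.
pose u N : shift_space := shift (hh N).1 stripes.
have cpt : compact [set: shift_space].
  have := @tychonoff Zsq (fun _ => bool) (fun _ => setT) (fun _ => bool_compact).
  by congr compact; apply/seteqP; split.
have [y [_ cy]] : [set: shift_space] `&` cluster (u @ \oo) !=set0.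
  exact: (cpt (u @ \oo) _ filterT).
have near_y M : exists2 N, (M <= N)%N & agree M y (u N).
  have nb : nbhs y [set z | agree M y z] by apply/nbhs_shift_spaceP; exists M.
  have ev : (u @ \oo) (u @` [set N | (M <= N)%N]).
    by exists M => // N /= MN; exists N.
  by have [_ [[N MN <-] yN]] := cy _ _ ev nb; exists N.
have fy : free_part y.
  move=> g /eqP/breaksP[T HT] E; have [N _ yN] := near_y (T + norm g)%N.
  have [t tT /eqP[]] := HT (hh N).1.
  have e1 : y t = stripes ((hh N).1 + t).
    by rewrite yN /u /shift 1?addrC //; move: tT; rewrite /in_box; lia.
  have e2 : y (t + g) = stripes ((hh N).1 + t + g).
    rewrite yN /u /shift; first by congr stripes; rewrite addrC addrA.
    by move: tT; rewrite /in_box /norm /=; lia.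
  by rewrite -e1 -e2 -{1}E.
pose Y : X := exist _ y (mem_set fy).
have [M HM] := lf Y; have [N MN yN] := near_y M.
have [HN ne] := Hhh N; apply: ne.
have h2 : agree M y (shift (hh N).2 stripes).
  by apply: agree_trans yN _; exact: agree_le HN.
by rewrite (HM (act (hh N).1 base) yN) (HM (act (hh N).2 base) h2).
Qed.

End Compactness.

Lemma column_period_log (k : nat) (i : int) :
  (2 ^ k <= `|i| < 2 ^ k.+1)%N -> column_period i = k.+1.
Proof. by move=> H; rewrite /column_period (trunc_log_eq _ H). Qed.

Lemma agree_periodic (N P : nat) (c j : int) :
  (forall i : int, `|2 * i + 1 - c| <= N%:Z -> (column_period i %| P)%N) ->
  agree N (shift (c, j + P%:Z) stripes) (shift (c, j) stripes).
Proof.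
move=> H -[a b] ab; rewrite /shift.
have [H0|H1] := eqVneq ((a + c) %% 2)%Z 0; first by rewrite /stripes /= H0.
have aE : a + c = 2 * ((a + c) %/ 2)%Z + 1 by lia.
have E k : ((a, b) : Zsq) + (c, k) = (2 * ((a + c) %/ 2)%Z + 1, b + k).
  by apply: Zsq_ext => /=.
rewrite !E !stripes_odd; congr toeplitz.
have /dvdnP[q ->] : (column_period ((a + c) %/ 2)%Z %| P)%N.
  by apply: H; move: ab; rewrite /in_box /=; lia.
by rewrite addrA PoszM addrC modzMDl.
Qed.

(** The two columns lie on either side of the place where the period changes from
    [k + 1] to [k + 2], at a distance just large enough that their windows lie
    in one strip each.  The choice of [k] makes [p] congruent to 1 mod 3. *)
Lemma two_strips (V : Type) (F : Zsq -> V) (N : nat) :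
  (forall h h', agree N (shift h stripes) (shift h' stripes) -> F h = F h') ->
  exists p D (c : int), [/\ (p %% 3 = 1)%N,
    forall j, F (c, j + p%:Z) = F (c, j),
    forall j, F (c + D%:Z, j + p.+1%:Z) = F (c + D%:Z, j) &
    forall (i : nat) j, (i <= D)%N -> F (c + i%:Z, j + (p * p.+1)%N%:Z) = F (c + i%:Z, j)].
Proof.
move=> HF; pose k := (3 * N + 3)%N; pose B : int := (2 * 2 ^ k.+1)%N%:Z.
have kN : (3 * N + 3 < 2 ^ k)%N by exact: ltn_expl.
have k1 : (2 ^ k.+1 = 2 * 2 ^ k)%N by rewrite expnS.
have k2 : (2 ^ k.+2 = 4 * 2 ^ k)%N by rewrite !expnS mulnA.
have pl (i : int) : B - (2 * N + 1)%N%:Z - N%:Z <= 2 * i + 1 -> 2 * i + 1 < B -> column_period i = k.+1.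
  by move=> h1 h2; apply: column_period_log; move: h1 h2; rewrite /B k1; lia.
have pr (i : int) : B <= 2 * i + 1 -> 2 * i + 1 <= B + 2 * N%:Z + 2 -> column_period i = k.+2.
  by move=> h1 h2; apply: column_period_log; move: h1 h2; rewrite /B k1 k2; lia.
exists k.+1, (2 * N + 1)%N, (B - N%:Z - 1); split.
- by rewrite /k; lia.
- by move=> j; apply/HF/agree_periodic => i iN; rewrite pl //; move: iN; clear; lia.
- by move=> j; apply/HF/agree_periodic => i iN; rewrite pr //; move: iN; clear; lia.
move=> i j iD; apply/HF/agree_periodic => i' iN.
have [lt|ge] := ltrP (2 * i' + 1) B.
  by rewrite pl ?dvdn_mulr //; move: iN iD; clear; lia.
by rewrite pr ?dvdn_mull //; move: iN iD; clear; lia.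
Qed.

(** * Weak orders certifying six-vertex tournaments *)

Section Certificates.
Local Open Scope nat_scope.

Definition six := iota 0 6.

Definition rel_of (m : seq (seq bool)) (a b : nat) : bool := nth false (nth [::] m a) b.

(** A certificate consists of a map [phi], read as a position on a circle that
    is cut below 0, and a map [psi].  An arc has winding 1 if [phi] decreases
    along it; arcs inside a class of [phi] have winding 0 and must raise [psi]
    by 1 mod 3. *)
Section Certificate.
Variables (T : rel nat) (phi psi : nat -> nat).

Definition mids (a d : nat) : seq nat := [seq b <- six | T a b && T b d].

(** A grid square determines a pair [(a, d)] of opposite corners with two middle
    vertices.  In the grid every vertex has a predecessor and a successor, so
    sources in place of [a] and sinks in place of [d] do not occur. *)
Definition squares : seq (nat * nat * seq nat) :=
  [seq s <- [seq (a, d, mids a d) | a <- [seq a <- six | has (T^~ a) six],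
                                    d <- [seq d <- six | has (T d) six]]
     | 1 < size s.2].

Definition turns (a b d : nat) : nat := (phi b < phi a) + (phi d < phi b).

Definition uniform (sq : seq (nat * nat * seq nat)) : bool :=
  all (fun s => constant [seq turns s.1.1 b s.1.2 | b <- s.2]) sq.

Definition bad_squares (sq : seq (nat * nat * seq nat)) : seq (nat * nat * nat * nat) :=
  [seq (s.1.1, bc.1, bc.2, s.1.2) | s <- sq,
     bc <- [seq bc <- [seq (b, c) | b <- s.2, c <- s.2]
              | turns s.1.1 bc.1 s.1.2 != turns s.1.1 bc.2 s.1.2]].

Definition ties_ok : bool :=
  all (fun a => all (fun b => T a b && (phi a == phi b) ==>
                              (psi a < 3) && (psi b == nth 0 [:: 1; 2; 0] (psi a))) six) six.

(** The condition under which a corner [c] of a square from [a] to [d] has all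
    its neighbours determined, and may therefore be replaced by [b]. *)
Definition forced (q : nat * nat * nat * nat) : bool :=
  let: (a, b, c, d) := q in
  [&& all (fun z => T z a ==> all (pred1 a) (mids z c)) six,
      all (fun z => T d z ==> all (pred1 d) (mids c z)) six &
      b \in mids a d].

Definition same_square (q r : nat * nat * nat * nat) : bool :=
  let: (a, b, c, d) := q in (r == q) || (r == (a, c, b, d)).

(** Conditionals in place of conjunctions, and [find] in place of [has] in
    [certifiable], stop the call-by-value evaluation early. *)
Definition flippable (sq : seq (nat * nat * seq nat)) : bool :=
  let bad := bad_squares sq in
  if size bad <= 2 then has (fun q => forced q && all (same_square q) bad) bad else false.

End Certificate.

Definition zeros : seq nat := nseq 6 0.

(** Positions for which, together, every tournament that contains the path
    0 -> 1 -> ... -> 5 passes the test. *)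
Definition certificates : seq (seq nat * seq nat) := [::
  ([:: 3; 4; 5; 0; 1; 2], zeros);
  ([:: 4; 0; 1; 2; 3; 5], zeros);
  ([:: 1; 5; 3; 2; 0; 4], zeros);
  ([:: 1; 0; 4; 3; 2; 5], zeros);
  ([:: 3; 0; 5; 4; 2; 1], zeros);
  ([:: 0; 5; 3; 1; 4; 2], zeros);
  ([:: 5; 3; 0; 4; 2; 1], zeros);
  ([:: 4; 5; 2; 3; 0; 1], zeros);
  ([:: 4; 1; 3; 5; 0; 2], zeros);
  ([:: 4; 2; 1; 5; 3; 0], zeros);
  ([:: 4; 5; 0; 2; 3; 1], zeros);
  ([:: 3; 1; 2; 4; 5; 0], zeros);
  ([:: 5; 4; 3; 0; 2; 1], zeros);
  ([:: 4; 3; 5; 2; 1; 0], zeros);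
  ([:: 0; 3; 2; 5; 4; 1], zeros);
  ([:: 5; 3; 1; 4; 2; 0], zeros);
  ([:: 1; 5; 4; 3; 0; 2], zeros);
  ([:: 1; 3; 0; 5; 4; 2], zeros);
  ([:: 4; 5; 1; 2; 0; 3], zeros);
  ([:: 1; 4; 2; 5; 3; 0], zeros);
  ([:: 3; 0; 4; 5; 1; 2], zeros);
  ([:: 0; 1; 4; 2; 3; 5], zeros);
  ([:: 1; 3; 4; 2; 5; 0], zeros);
  ([:: 0; 3; 1; 5; 2; 4], zeros);
  ([:: 2; 0; 3; 5; 1; 4], zeros);
  ([:: 4; 1; 2; 0; 3; 5], zeros);
  ([:: 3; 5; 2; 0; 1; 4], zeros);
  ([:: 0; 1; 2; 2; 2; 3], [:: 0; 0; 0; 1; 2; 0]);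
  ([:: 2; 2; 3; 0; 1; 2], [:: 0; 1; 0; 0; 0; 2]);
  ([:: 0; 1; 1; 1; 2; 3], [:: 0; 0; 1; 2; 0; 0]);
  ([:: 3; 0; 1; 2; 3; 3], [:: 0; 0; 0; 0; 1; 2]);
  ([:: 0; 1; 2; 3; 3; 3], [:: 0; 0; 0; 0; 1; 2]);
  ([:: 2; 2; 2; 3; 0; 1], [:: 0; 1; 2; 0; 0; 0]);
  ([:: 3; 2; 5; 1; 4; 0], zeros);
  ([:: 4; 2; 5; 3; 0; 1], zeros);
  ([:: 3; 0; 2; 5; 4; 1], zeros);
  ([:: 4; 1; 2; 5; 3; 0], zeros);
  ([:: 1; 3; 3; 3; 0; 2], [:: 0; 0; 1; 2; 0; 0]);
  ([:: 1; 3; 3; 0; 2; 3], [:: 0; 0; 1; 0; 0; 2]);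
  ([:: 0; 1; 1; 2; 3; 1], [:: 0; 0; 1; 0; 0; 2]);
  ([:: 3; 3; 1; 0; 3; 2], [:: 0; 1; 0; 0; 2; 0]);
  ([:: 3; 3; 1; 2; 3; 0], [:: 0; 1; 0; 0; 2; 0]);
  ([:: 1; 0; 3; 2; 0; 0], [:: 0; 0; 0; 0; 1; 2]);
  ([:: 1; 3; 2; 1; 1; 0], [:: 0; 0; 0; 1; 2; 0]);
  ([:: 1; 0; 2; 1; 1; 3], [:: 0; 0; 0; 1; 2; 0]);
  ([:: 0; 1; 2; 3; 1; 1], [:: 0; 0; 0; 0; 1; 2]);
  ([:: 1; 3; 0; 0; 0; 2], [:: 0; 0; 0; 1; 2; 0])].

Definition certifiable (m : seq (seq bool)) : bool :=
  let T := rel_of m in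
  let sq := squares T in
  let good P c := if P (nth 0 c.1) then ties_ok T (nth 0 c.1) (nth 0 c.2) else false in
  let found P := find (good P) certificates < size certificates in
  if found (fun phi => uniform phi sq) then true else found (fun phi => flippable T phi sq).

Definition matrix_of (s : seq bool) : seq (seq bool) :=
  if s is [:: b02; b03; b04; b05; b13; b14; b15; b24; b25; b35] then
    [:: [:: false; true; b02; b03; b04; b05];
        [:: false; false; true; b13; b14; b15];
        [:: ~~ b02; false; false; true; b24; b25];
        [:: ~~ b03; ~~ b13; false; false; true; b35];
        [:: ~~ b04; ~~ b14; ~~ b24; false; false; true];
        [:: ~~ b05; ~~ b15; ~~ b25; ~~ b35; false; false]]
  else [::].

Fixpoint all_bitseqs (n : nat) (P : pred (seq bool)) : bool :=
  if n is n'.+1 then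
    all_bitseqs n' (fun s => P (true :: s)) && all_bitseqs n' (fun s => P (false :: s))
  else P [::].

Lemma all_bitseqsP n P : all_bitseqs n P -> forall s, size s = n -> P s.
Proof.
elim: n P => [|n IH] P /= => [H [] //|/andP[Ht Hf] [//|[] s] [sn]].
  exact: IH Ht s sn.
exact: IH Hf s sn.
Qed.

Lemma all_certifiable : all_bitseqs 10 (fun s => certifiable (matrix_of s)).
Proof. vm_compute. reflexivity. Qed.

End Certificates.

(** * Winding numbers of periodic columns *)

Definition plane_hom (T : rel nat) (F : Zsq -> nat) : Prop :=
  [/\ forall h, (F h < 6)%N, forall h, T (F h) (F (h + e1)) & forall h, T (F h) (F (h + e2))].

Definition windowed (V : Type) (F : Zsq -> V) : Prop :=
  exists N, forall h h', agree N (shift h stripes) (shift h' stripes) -> F h = F h'.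

Section Winding.
Variables (T : rel nat) (phi psi : nat -> nat) (F : Zsq -> nat).
Hypothesis hF : plane_hom T F.
Hypothesis wF : windowed F.

Hypothesis squareF : forall h,
  turns phi (F h) (F (h + e1)) (F (h + e1 + e2)) = turns phi (F h) (F (h + e2)) (F (h + e1 + e2)).
Hypothesis tieF : forall a b, (a < 6)%N -> (b < 6)%N -> T a b -> phi a = phi b ->
  (psi b = (psi a).+1 %[mod 3])%N.

Let w (a b : nat) : nat := (phi b < phi a)%N.

Definition column (c : int) (n : nat) : nat :=
  \sum_(j < n) w (F (c, j%:Z)) (F (c, j.+1%:Z)).

Lemma column_le c n : (column c n <= n)%N.
Proof.
rewrite -[X in (_ <= X)%N]muln1 -[X in (_ <= X * _)%N]card_ord -sum_nat_const.
by apply: leq_sum => j _; rewrite /w; case: (_ < _)%N.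
Qed.

Lemma column_periodic c P q : (forall j, F (c, j + P%:Z) = F (c, j)) ->
  column c (q * P) = (q * column c P)%N.
Proof.
move=> per; elim: q => [|q IH]; first by rewrite !mul0n /column big_ord0.
have E k : F (c, (P + k)%N%:Z) = F (c, k%:Z) by rewrite -(per k%:Z) PoszD addrC.
rewrite !mulSn -IH /column big_split_ord /=; congr (_ + _)%N.
by apply: eq_bigr => j _; rewrite -addnS !E.
Qed.

(** Both sides are the winding of a path from [(c, 0)] to [(c + 1, n)]. *)
Lemma column_next c n :
  (column c n + w (F (c, n%:Z)) (F ((c + 1)%R, n%:Z)) =
   w (F (c, 0%Z)) (F ((c + 1)%R, 0%Z)) + column (c + 1)%R n)%N.
Proof.
elim: n => [|n IH]; first by rewrite /column !big_ord0 addn0.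
have := squareF (c, n%:Z).
have -> : (c, n%:Z) + e1 = (c + 1, n%:Z) by apply: Zsq_ext => /=; lia.
have -> : (c, n%:Z) + e2 = (c, n.+1%:Z) by apply: Zsq_ext => /=; lia.
have -> : (c + 1, n%:Z) + e2 = (c + 1, n.+1%:Z) by apply: Zsq_ext => /=; lia.
move: IH; rewrite /column !big_ord_recr /= /turns -/(w _ _) -/(w _ _) -/(w _ _) -/(w _ _).
lia.
Qed.

(** The windings [a] and [b] of one period in the two strips satisfy
    [(p + 1) a = p b], so [a] is 0 or [p].  In the first case [phi] is constant
    along the column, so [psi] increases by [p] mod 3 over one period although
    [p] is 1 mod 3; in the second case [phi] decreases at every step. *)
Lemma no_winding : False.
Proof.
have [N HN] := wF; have [p [D [c [p3 per1 per2 per]]]] := two_strips HN.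
have [F6 T1 T2] := hF.
have T2' k : T (F (c, k%:Z)) (F (c, k.+1%:Z)).
  by have := T2 (c, k%:Z); congr (T _ (F _)); apply: Zsq_ext => /=; lia.
have same i : (i <= D)%N -> column (c + i%:Z) (p * p.+1) = column c (p * p.+1).
  elim: i => [|i IH] iD; first by rewrite addr0.
  have := column_next (c + i%:Z) (p * p.+1); rewrite -IH; last by lia.
  have -> : c + i%:Z + 1 = c + i.+1%:Z by lia.
  have := per i 0 ltac:(lia); have := per i.+1 0 ltac:(lia).
  by rewrite !add0r => -> ->; move=> H; apply/eqP; rewrite -(eqn_add2r (w (F (c + i%:Z, 0)) (F (c + i.+1%:Z, 0)))) [in X in _ == X]H addnC.
have E := same D (leqnn D).
have E1 : column c (p * p.+1) = (p.+1 * column c p)%N.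
  by rewrite mulnC (column_periodic p.+1 per1).
rewrite (column_periodic p per2) E1 in E.
have pd : (p %| column c p)%N.
  by rewrite -(@Gauss_dvdr p p.+1) ?coprimenS // -E dvdn_mulr.
have F_p : F (c, p%:Z) = F (c, 0%Z) by rewrite -[p%:Z]add0r per1.
have [col0|colp] : column c p = 0%N \/ column c p = p.
  case/dvdnP: pd => q qE; have := column_le c p; rewrite qE.
  by case: q {qE} => [|[|q]] H; [left|right|exfalso]; nia.
- have w0 j : (j < p)%N -> w (F (c, j%:Z)) (F (c, j.+1%:Z)) = 0%N.
    move=> jp; move/eqP: col0; rewrite /column sum_nat_eq0 => /forallP /(_ (Ordinal jp)) /=.
    by move/eqP.
  have mono i j : (i + j <= p)%N -> (phi (F (c, i%:Z)) <= phi (F (c, (i + j)%N%:Z)))%N.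
    elim: j => [|j IH] ij; first by rewrite addn0.
    apply: leq_trans (IH _) _; first by lia.
    by have := @w0 (i + j)%N ltac:(lia); rewrite addnS /w; case: ltnP.
  have const j : (j <= p)%N -> phi (F (c, j%:Z)) = phi (F (c, 0%Z)).
    move=> jp; have := mono 0%N j jp; have := mono j (p - j)%N ltac:(lia).
    by rewrite subnKC // F_p add0n => h1 h2; apply/eqP; rewrite eqn_leq h1 h2.
  have psij j : (j <= p)%N -> (psi (F (c, j%:Z)) = psi (F (c, 0%Z)) + j %[mod 3])%N.
    elim: j => [|j IH] jp; first by rewrite addn0.
    rewrite (tieF (F6 _) (F6 _) (T2' j)); last by rewrite !const //; lia.
    by have := IH ltac:(lia); lia.
  by have := psij p (leqnn p); rewrite F_p; lia.
have w1 j : (j < p)%N -> w (F (c, j%:Z)) (F (c, j.+1%:Z)) = 1%N.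
  move=> jp; apply/eqP; apply: contraT => wn.
  have : (column c p < p)%N.
    rewrite /column (bigD1 (Ordinal jp)) //=.
    have -> : w (F (c, j%:Z)) (F (c, j.+1%:Z)) = 0%N by move: wn; rewrite /w; case: (_ < _)%N.
    rewrite add0n; apply: leq_ltn_trans (_ : p.-1 < p)%N; last by lia.
    have -> : p.-1 = \sum_(i < p | i != Ordinal jp) 1.
      by rewrite sum1_card; have := cardC1 (Ordinal jp); rewrite card_ord => <-; apply: eq_card.
    by apply: leq_sum => i _; rewrite /w; case: (_ < _)%N.
  by rewrite colp ltnn.
have down j : (j <= p)%N -> (phi (F (c, j%:Z)) + j <= phi (F (c, 0%Z)))%N.
  elim: j => [|j IH] jp; first by rewrite addn0.
  have := IH ltac:(lia); have := w1 j jp; rewrite /w; case: ltnP => // lt _ le.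
  by lia.
by have := down p (leqnn p); rewrite F_p; lia.
Qed.

End Winding.

(** * Removing one kind of bad square *)

Section Soundness.
Variable T : rel nat.
Hypothesis T_irr : forall a, T a a = false.

Lemma mem_six a : (a \in six) = (a < 6)%N.
Proof. by rewrite mem_iota. Qed.

Lemma mem_mids a b d : (b \in mids T a d) = [&& T a b, T b d & (b < 6)%N].
Proof. by rewrite mem_filter mem_six andbA. Qed.

Lemma mem_bad_squares phi a b c d :
  reflect [/\ (a, d, mids T a d) \in squares T, b \in mids T a d, c \in mids T a d &
           turns phi a b d != turns phi a c d]
          ((a, b, c, d) \in bad_squares phi (squares T)).
Proof.
apply: (iffP idP).
  case/allpairsPdep => -[[a' d'] ms] [[b' c']] [sq] bcm [-> -> -> ->].
  move: bcm; rewrite mem_filter => /andP[tn /allpairsP[[b'' c'']] [bm cm [bE cE]]].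
  have msE : ms = mids T a' d'.
    by move: sq; rewrite mem_filter => /andP[_ /allpairsP[[x y]] [_ _ [-> -> ->]]].
  by rewrite bE cE -msE; move: tn; rewrite bE cE.
case=> sq bm cm tn; apply/allpairsPdep; exists (a, d, mids T a d), (b, c); split=> //.
by rewrite mem_filter tn; apply/allpairsP; exists (b, c).
Qed.

Lemma square_or_bad phi F h : plane_hom T F ->
  turns phi (F h) (F (h + e1)) (F (h + e1 + e2)) = turns phi (F h) (F (h + e2)) (F (h + e1 + e2))
  \/ (F h, F (h + e1), F (h + e2), F (h + e1 + e2)) \in bad_squares phi (squares T).
Proof.
case=> F6 T1 T2; have [|ne] := eqVneq (turns phi (F h) (F (h + e1)) (F (h + e1 + e2)))
  (turns phi (F h) (F (h + e2)) (F (h + e1 + e2))); first by left.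
right; have bm : F (h + e1) \in mids T (F h) (F (h + e1 + e2)).
  by rewrite mem_mids T1 T2 F6.
have cm : F (h + e2) \in mids T (F h) (F (h + e1 + e2)).
  by rewrite mem_mids T2 F6 addrAC T1.
apply/mem_bad_squares; split=> //; rewrite /squares mem_filter; apply/andP; split.
  rewrite /=; move: bm cm ne; case: (mids _ _ _) => [//|x [|//]].
  by rewrite !inE => /eqP-> /eqP->; rewrite eqxx.
apply/allpairsP; exists (F h, F (h + e1 + e2)); split=> //;
  rewrite mem_filter mem_six F6 andbT; apply/hasP.
  by exists (F (h - e1)); rewrite ?mem_six //= -{2}(subrK e1 h).
by exists (F (h + e1 + e2 + e1)); rewrite ?mem_six /=.
Qed.

Lemma uniform_no_bad phi : uniform phi (squares T) -> bad_squares phi (squares T) =i [::].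
Proof.
move=> /allP U [[[a b] c] d]; rewrite in_nil; apply/negP => /mem_bad_squares[sq bm cm].
have := U _ sq; rewrite /=; case: (mids T a d) bm cm => [//|x s] bm cm /=.
move=> /allP H; have E y : y \in x :: s -> turns phi a y d = turns phi a x d.
  by rewrite inE => /orP[/eqP->//|ys]; apply/eqP; apply: (H (turns phi a y d)); exact: map_f.
by rewrite !E // eqxx.
Qed.

Lemma ties_okP phi psi : ties_ok T phi psi -> forall a b, (a < 6)%N -> (b < 6)%N -> T a b ->
  phi a = phi b -> (psi b = (psi a).+1 %[mod 3])%N.
Proof.
move=> /allP H a b a6 b6 ab E; have := H a; rewrite mem_six a6 => /(_ isT) /allP /(_ b).
rewrite mem_six b6 ab E eqxx => /(_ isT) /andP[+ /eqP->].
by case: (psi a) => [|[|[|]]].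
Qed.

Section Flip.
Variables (F : Zsq -> nat) (a0 b0 c0 d0 : nat).

Definition flipped (h : Zsq) : bool :=
  [&& F h == c0, F (h - e1) == a0, F (h - e2) == a0, F (h + e1) == d0 & F (h + e2) == d0].

Definition flip (h : Zsq) : nat := if flipped h then b0 else F h.

Lemma windowed_flip : windowed F -> windowed flip.
Proof.
case=> N HN; exists N.+1 => h h' hh'.
have E g : (norm g <= 1)%N -> F (h + g) = F (h' + g).
  move=> g1; apply: HN => t tN; rewrite /shift !(addrC _ g) !addrA; apply: hh'.
  by move: g1 tN; rewrite /norm /in_box /=; lia.
by have := E 0 isT; rewrite /flip /flipped !addr0 => ->; rewrite !E.
Qed.

Hypothesis b0m : b0 \in mids T a0 d0.
Hypothesis c0m : c0 \in mids T a0 d0.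
Hypothesis bc : b0 != c0.
Hypothesis hF : plane_hom T F.

(** The neighbours of a replaced vertex are [a0] and [d0], which are not
    replaced, and [b0] fits between them as well as [c0] does. *)
Lemma plane_hom_flip : plane_hom T flip.
Proof.
have [F6 T1 T2] := hF; move: b0m c0m; rewrite !mem_mids => /and3P[ab bd b6] /and3P[ac cd _].
have ne x y : T x y -> x != y by move=> xy; apply: contraTneq xy => ->; rewrite T_irr.
have step e : (forall h, flipped h -> F (h - e) == a0 /\ F (h + e) == d0) ->
    (forall h, T (F h) (F (h + e))) -> forall h, T (flip h) (flip (h + e)).
  move=> fl Te h; rewrite /flip; case fh : (flipped h); case fhe : (flipped (h + e)) => //.
  - have [_ /eqP d] := fl _ fh; case/and5P: fhe; rewrite d => /eqP dc.
    by move: cd; rewrite dc T_irr.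
  - by have [_ /eqP->] := fl _ fh.
  by have := (fl _ fhe).1; rewrite addrK => /eqP->.
split.
- by move=> h; rewrite /flip; case: ifP.
- by apply: step => // h /and5P[].
by apply: step => // h /and5P[].
Qed.

Hypothesis lower : forall z, (z < 6)%N -> T z a0 -> {subset mids T z c0 <= [:: a0]}.
Hypothesis upper : forall z, (z < 6)%N -> T d0 z -> {subset mids T c0 z <= [:: d0]}.

(** After the replacement no square from [a0] to [d0] has a corner [c0]: the
    hypotheses determine the other two neighbours of such a corner, so it would
    have been replaced. *)
Lemma flip_corner h e e' : (e, e') \in [:: (e1, e2); (e2, e1)] ->
  flip h = a0 -> flip (h + e) = c0 -> flip (h + e + e') = d0 -> False.
Proof.
have [F6 T1 T2] := hF; move: b0m c0m; rewrite !mem_mids => /and3P[ab bd b6] /and3P[ac cd _].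
have ne x y : T x y -> x != y by move=> xy; apply: contraTneq xy => ->; rewrite T_irr.
have unfl x k : x != b0 -> flip k = x -> F k = x.
  by rewrite /flip; case: ifP => // _ /eqP nx E; case: nx.
move=> ee ha hc hd.
have Fa : F h = a0 by apply: unfl ha; exact: ne.
have Fc : F (h + e) = c0 by apply: unfl hc; rewrite eq_sym.
have Fd : F (h + e + e') = d0 by apply: unfl hd; rewrite eq_sym; exact: ne.
have Te k : T (F k) (F (k + e)) by move: ee; rewrite !inE => /orP[] /eqP[-> _].
have Te' k : T (F k) (F (k + e')) by move: ee; rewrite !inE => /orP[] /eqP[_ ->].
have lo : F (h + e - e') = a0.
  have p1 : T (F (h - e')) a0 by have := Te' (h - e'); rewrite subrK Fa.
  have p2 : T (F (h - e')) (F (h + e - e')) by rewrite addrAC; exact: Te.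
  have p3 : T (F (h + e - e')) c0 by have := Te' (h + e - e'); rewrite subrK Fc.
  apply/eqP; rewrite -mem_seq1; apply: (lower (F6 _) p1).
  by rewrite mem_mids F6 p2 p3.
have up : F (h + e + e) = d0.
  have p1 : T d0 (F (h + e + e' + e)) by rewrite -Fd; exact: Te.
  have p2 : T (F (h + e + e)) (F (h + e + e' + e)) by rewrite (addrAC _ e' e); exact: Te'.
  have p3 : T c0 (F (h + e + e)) by rewrite -Fc; exact: Te.
  apply/eqP; rewrite -mem_seq1; apply: (upper (F6 _) p1).
  by rewrite mem_mids F6 p2 p3.
have : flipped (h + e).
  rewrite /flipped Fc eqxx /=; move: ee; rewrite !inE => /orP[] /eqP[E E'];
  by move: lo up Fa Fd; rewrite E E' addrK => -> -> -> ->; rewrite !eqxx.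
by move=> fl; move: hc; rewrite /flip fl => /eqP; rewrite (negbTE bc).
Qed.

End Flip.

End Soundness.

Theorem certifiable_no_hom (m : seq (seq bool)) (F : Zsq -> nat) :
  (forall a, rel_of m a a = false) -> certifiable m ->
  plane_hom (rel_of m) F -> windowed F -> False.
Proof.
move=> irr; rewrite /certifiable; set T := rel_of m.
have getc P : (find (fun c : seq nat * seq nat => if P (nth 0%N c.1) then ties_ok T (nth 0%N c.1) (nth 0%N c.2) else false)
    certificates < size certificates)%N ->
    exists phi psi, P phi /\ ties_ok T phi psi.
  rewrite -has_find => /hasP[c _]; case: ifP => // Pc tc.
  by exists (nth 0%N c.1), (nth 0%N c.2).
case: ifP => [/(getc (fun phi => uniform phi (squares T)))[phi [psi [U ties]]] _
             |_ /(getc (fun phi => flippable T phi (squares T)))[phi [psi [fl ties]]]] hF wF.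
  apply: (@no_winding T phi psi F hF wF _ (ties_okP ties)) => h.
  by have [//|] := square_or_bad phi h hF; rewrite uniform_no_bad.
move: fl; rewrite /flippable; case: ifP => // _ /hasP[[[[a0 b0] c0] d0] q /andP[/and3P[lo up b0m] /allP same]].
have /mem_bad_squares[_ _ c0m tn] := q.
have bc : b0 != c0 by apply: contraNneq tn => ->.
have lower z : (z < 6)%N -> T z a0 -> {subset mids T z c0 <= [:: a0]}.
  move=> z6 za x xm; have := allP lo z; rewrite mem_six z6 za => /(_ isT) /allP /(_ x xm).
  by rewrite inE.
have upper z : (z < 6)%N -> T d0 z -> {subset mids T c0 z <= [:: d0]}.
  move=> z6 za x xm; have := allP up z; rewrite mem_six z6 za => /(_ isT) /allP /(_ x xm).
  by rewrite inE.
have hF' := plane_hom_flip irr b0m c0m hF.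
have corner := flip_corner irr b0m c0m bc hF lower upper.
apply: (@no_winding T phi psi _ hF' (windowed_flip a0 b0 c0 d0 wF) _ (ties_okP ties)) => h.
have [//|bad] := square_or_bad phi h hF'; exfalso.
have /orP[/eqP[Ea _ Ec Ed]|/eqP[Ea Eb _ Ed]] := same _ bad.
  by apply: (corner h e2 e1); rewrite ?inE ?eqxx ?orbT // -addrA (addrC e2) addrA.
by apply: (corner h e1 e2); rewrite ?inE ?eqxx.
Qed.

(** * Tournaments on six vertices *)

Section Tournament.
Variable T : rel nat.
Hypothesis T_irr : forall a, T a a = false.
Hypothesis T_anti : forall a b, a != b -> T b a = ~~ T a b.

(** Redei's theorem: sorting by a total relation, transitive or not, produces a
    sequence in which consecutive entries are related. *)
Lemma hamiltonian_labelling : exists s : seq nat,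
  [/\ perm_eq s six & forall i, (i < 5)%N -> T (nth 0%N s i) (nth 0%N s i.+1)].
Proof.
pose leT x y := (x == y) || T x y.
have tot : total leT.
  by move=> x y; rewrite /leT; case: eqVneq => //= xy; rewrite (T_anti xy) orbN.
exists (sort leT six); have ps : perm_eq (sort leT six) six by rewrite perm_sort.
split=> // i i5; have sz : size (sort leT six) = 6 by rewrite size_sort.
have := sort_sorted tot six => /(sortedP 0%N) /(_ i); rewrite sz => /(_ i5) /orP[|//].
by rewrite nth_uniq ?sz ?sort_uniq ?iota_uniq //; lia.
Qed.

Lemma tournament_matrix : exists (s : seq nat) (m : seq (seq bool)),
  [/\ perm_eq s six, certifiable m, forall a, rel_of m a a = false &
   forall i j, (i < 6)%N -> (j < 6)%N -> rel_of m i j = T (nth 0%N s i) (nth 0%N s j)].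
Proof.
have [s [ps path]] := hamiltonian_labelling.
pose S i j := T (nth 0%N s i) (nth 0%N s j).
pose bits := [:: S 0 2; S 0 3; S 0 4; S 0 5; S 1 3; S 1 4; S 1 5; S 2 4; S 2 5; S 3 5]%N.
exists s, (matrix_of bits); split=> //.
- exact: (all_bitseqsP all_certifiable).
- by do 6?[case=> //]; move=> n; rewrite /rel_of /= nth_nil.
have us : uniq s by rewrite (perm_uniq ps).
have sz : size s = 6 by rewrite (perm_size ps).
have irr i : S i i = false by exact: T_irr.
have anti i j : (i < j < 6)%N -> S j i = ~~ S i j.
  by move=> ij; apply: T_anti; rewrite nth_uniq ?sz //; lia.
have up i : (i < 5)%N -> S i i.+1 = true by exact: path.
have dn i : (i < 5)%N -> S i.+1 i = false by move=> i5; rewrite anti ?up //; lia.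
move=> i j i6 j6; rewrite -/(S i j).
by do 6?[case: i i6 => [|i] i6 //]; do 6?[case: j j6 => [|j] j6 //];
  rewrite /rel_of /= ?irr ?up ?dn //; apply/esym/anti.
Qed.

End Tournament.

(** The image is completed to a tournament on six vertices by orienting the
    missing pairs upwards. *)
Theorem six_do_not_suffice n : has_continuous_hom_of_size schreier_graph n -> (7 <= n)%N.
Proof.
case=> W [H [f [Wn cf hf]]]; rewrite leqNgt; apply/negP => n7.
have lf : local f by exact/continuous_local.
pose num (a : W) : nat := enum_rank a.
have num_inj : injective num by move=> a b /val_inj/enum_rank_inj.
have num6 a : (num a < 6)%N by apply: leq_trans (ltn_ord (enum_rank a)) _; rewrite Wn.
pose A i j := `[< exists a b, [/\ num a = i, num b = j & Defs.arc H a b] >].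
have A_irr i : A i i = false.
  by apply/asboolP => -[a [b [<- /num_inj-> ]]]; exact: arc_irreflexive.
have A_anti i j : A i j -> A j i = false.
  move=> /asboolP[a [b [ai bj ab]]]; apply/asboolP => -[c [d [cj di cd]]].
  have E1 : c = b by apply: num_inj; rewrite cj bj.
  have E2 : d = a by apply: num_inj; rewrite di ai.
  by move: cd; rewrite E1 E2; exact: arc_asymmetric ab.
pose T i j := A i j || (~~ A j i && (i < j)%N).
have T_irr i : T i i = false by rewrite /T A_irr ltnn.
have T_anti i j : i != j -> T j i = ~~ T i j.
  rewrite /T; case E: (A i j); first by rewrite (A_anti _ _ E).
  by case: (A j i) => //=; case: ltngtP.
have [s [m [ps cert irr mT]]] := tournament_matrix T_irr T_anti.
pose F (h : Zsq) : nat := index (num (f (act h base))) s.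
have sz : size s = 6 by rewrite (perm_size ps).
have ms a : num a \in s by rewrite (perm_mem ps) mem_six.
have F6 h : (F h < 6)%N by have := ms (f (act h base)); rewrite -index_mem sz.
have hom e : (forall x, schreier_arc x (act e x)) -> forall h, rel_of m (F h) (F (h + e)).
  move=> He h; rewrite mT // !nth_index //; apply/orP; left; apply/asboolP.
  exists (f (act h base)), (f (act (h + e) base)); split=> //.
  by apply: hf; rewrite addrC actD; exact: He.
apply: (@certifiable_no_hom m F) => //.
  split=> //; apply: hom => x; apply/schreier_arcP; [by left|by right].
have [N HN] := uniform_window lf; exists N => h h' hh'.
by rewrite /F (HN _ _ hh').
Qed.

Local Close Scope ring_scope.

Theorem theorem1p1 : chi_co schreier_graph = Some 7.
Proof. by apply/chi_coP; split; [exact: seven_suffice|exact: six_do_not_suffice]. Qed.
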